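(* Let $f\in L^1(\mathbb R_+,*_{1/2})$ with $\widehat f\ge 0$. The following are equivalent: \begin{enumerate} \item $f$ is square integrable in a neighbourhood of the identity $0$ (that is, $\int_U|f|^2\,d\omega<\infty$ for some neighbourhood $U$ of $0$ in $\mathbb R_+$); \item $\widehat f\in (L^1,\ell^2)(\mathbb R_+,*_{1/2})$; \item $f\in (L^2,\ell^\infty)(\mathbb R_+,*_{1/2})$. \end{enumerate}
   Context: $(\mathbb R_+,*_{1/2})$, $\mathbb R_+=[0,\infty)$, is the Bessel–Kingman (motion) hypergroup with parameter $\alpha=\frac12$: a commutative hypergroup with identity $0$ and identity involution, convolution $\varepsilon_x*\varepsilon_0=\varepsilon_x=\varepsilon_0*\varepsilon_x$ and, for $x,y>0$, $\int f\,d(\varepsilon_x*\varepsilon_y)=\frac1{2xy}\int_{|x-y|}^{x+y}f(z)\,z\,dz$. Its Haar measure is $\omega(dz)=z^2\,dz$, and $L^p(\mathbb R_+,*_{1/2})=L^p(\mathbb R_+,\omega)$. The characters are $\varphi_\lambda(x)=\frac{\sin\lambda x}{\lambda x}$, $\lambda\ge0$ ($\varphi_0\equiv1$, $\varphi_\lambda(0)=1$). The Fourier transform of $f\in L^1(\mathbb R_+,\omega)$ is $\widehat f(\varphi_\lambda)=\int_{\mathbb R_+}f\varphi_\lambda\,d\omega$, regarded as a function of $\lambda\in\mathbb R_+$ through the identification $\lambda\leftrightarrow\varphi_\lambda$ of $(\mathbb R_+,*_{1/2})$ with its dual. Let $I_n=[n-1,n)$ for $n\in\mathbb N=\{1,2,\dots\}$.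 For $1\le p,q<\infty$ and measurable $f$, $$\|f\|_{p,q}=\Big(\sum_{n=1}^\infty\omega(I_n)\Big(\frac1{\omega(I_n)}\int_{n-1}^n|f|^p\,d\omega\Big)^{q/p}\Big)^{1/q},\qquad \|f\|_{p,\infty}=\sup_n\Big(\frac1{\omega(I_n)}\int_{n-1}^n|f|^p\,d\omega\Big)^{1/p},$$ and $(L^p,\ell^q)(\mathbb R_+,*_{1/2})=\{f\text{ measurable}:\|f\|_{p,q}<\infty\}$. *)

(* Defs.v *)
From HB Require Import structures.
From mathcomp Require Import all_boot all_order all_algebra.
From mathcomp Require Import all_classical all_reals all_analysis.
From mathcomp Require Import measurable_realfun complex.

Set Implicit Arguments.
Unset Strict Implicit.
Unset Printing Implicit Defensive.

Import Order.TTheory GRing.Theory Num.Theory.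
Import numFieldNormedType.Exports.

Local Open Scope classical_set_scope.
Local Open Scope complex_scope.
Local Open Scope ring_scope.

Definition halfline (R : realType) : set R := `[0, +oo[%classic.
Arguments halfline : clear implicits.

(* The measure z^2 dz, carried by [0, +oo[ but seen as a measure on the Borel
   sets of the whole real line. *)
Definition omega (R : realType) (A : set (measurableTypeR R)) : \bar R :=
  (\int[@lebesgue_measure R]_(z in A) (z ^+ 2 * \1_(halfline R) z)%:E)%E.
Arguments omega : clear implicits.

Section omega_measure.
Variable R : realType.

Let dens_ge0 (z : R) : (0 <= (z ^+ 2 * \1_(halfline R) z)%:E)%E.
Proof. by rewrite lee_fin mulr_ge0 ?sqr_ge0. Qed.

Let measurable_dens : measurable_fun [set: R]
  (fun z : R => (z ^+ 2 * \1_(halfline R) z)%:E).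
Proof.
apply/measurable_EFinP/measurable_funM; first exact: measurable_funX.
by apply: measurable_indic; exact: measurable_itv.
Qed.

Let omega0 : omega R set0 = 0%E.
Proof. by rewrite /omega integral_set0. Qed.

Let omega_ge0 (A : set (measurableTypeR R)) : (0 <= omega R A)%E.
Proof. exact: integral_ge0. Qed.

Let omega_sigma_additive : semi_sigma_additive (omega R).
Proof. exact: semi_sigma_additive_nng_induced. Qed.

HB.instance Definition _ := isMeasure.Build _ _ _ (omega R)
  omega0 omega_ge0 omega_sigma_additive.

End omega_measure.

Definition cmod (R : realType) (z : R[i]) : R := ComplexField.Normc.normc z.

Definition cmeasurable (R : realType) (D : set R) (f : R -> R[i]) : Prop :=
  measurable_fun D (fun x => complex.Re (f x)) /\
  measurable_fun D (fun x => complex.Im (f x)).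

Definition cintegral (R : realType)
    (mu : {measure set (measurableTypeR R) -> \bar R}) (D : set R) (f : R -> R[i]) : R[i] :=
  (\int[mu]_(x in D) complex.Re (f x)) +i* (\int[mu]_(x in D) complex.Im (f x)).

(* A complex function on [0, +oo[ is represented by a function on R whose
   values at negative arguments are irrelevant. *)
Definition L1omega (R : realType) : set (R -> R[i]) :=
  [set f | cmeasurable (halfline R) f /\
    (\int[omega R]_(x in halfline R) (cmod (f x))%:E < +oo)%E].
Arguments L1omega : clear implicits.

Definition phi (R : realType) (lambda x : R) : R :=
  if lambda * x == 0 then 1 else sin (lambda * x) / (lambda * x).

Definition fourier (R : realType) (f : R -> R[i]) (lambda : R) : R[i] :=
  cintegral (omega R) (halfline R) (fun x => f x * (phi lambda x)%:C).

Definition unit_itv (R : realType) (n : nat) : set R :=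
  `[n%:R - 1, n%:R[%classic.
Arguments unit_itv : clear implicits.

Definition mean_pow (R : realType) (p : R) (f : R -> R[i]) (n : nat) : \bar R :=
  ((omega R (unit_itv R n))^-1 *
    \int[omega R]_(x in unit_itv R n) (cmod (f x) `^ p)%:E)%E.

(* The outer exponent q is a real number or +oo; -oo is a junk case. *)
Definition amalgam_norm (R : realType) (p : R) (q : \bar R) (f : R -> R[i]) :
    \bar R :=
  match q with
  | EFin q0 =>
      ((\sum_(1 <= n <oo) omega R (unit_itv R n) * mean_pow p f n `^ (q0 / p))
        `^ q0^-1)%E
  | _ => ereal_sup [set (mean_pow p f n `^ p^-1)%E | n in [set n | (1 <= n)%N]]
  end.

Definition amalgam (R : realType) (p : R) (q : \bar R) : set (R -> R[i]) :=
  [set f | cmeasurable (halfline R) f /\ (amalgam_norm p q f < +oo)%E].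

(* U ranges over the neighbourhoods of 0 in the subspace [0, +oo[. *)
Definition square_integrable_near0 (R : realType) (f : R -> R[i]) : Prop :=
  exists U : set R,
    [/\ U `<=` halfline R, measurable U,
        within (halfline R) (nbhs (0 : R)) U &
        (\int[omega R]_(x in U) (cmod (f x) ^+ 2)%:E < +oo)%E].

(* Main.v *)
Require Import Defs.
From mathcomp Require Import all_boot all_order all_algebra.
From mathcomp Require Import all_classical all_reals all_analysis.
From mathcomp Require Import complex ring lra measurable_realfun.

Import Order.TTheory GRing.Theory Num.Theory.
Import numFieldNormedType.Exports.

Local Open Scope classical_set_scope.
Local Open Scope ring_scope.

Set Implicit Arguments.
Unset Strict Implicit.
Unset Printing Implicit Defensive.

(** Write [g x = x * Re (f x)] and [p x = x ^+ 2 * Re (f x)] for [x >= 0].  Since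
[s * x * phi s x = sin (s * x)], the real part [F] of the Fourier transform of
[f] is the integral of [p y * phi s y], and [s * F s] is the sine transform of
[g].  In these terms the three conditions say: (1) [g ^+ 2] is integrable near 0;
(2) the masses [b_m] of [s * F s] on [m - 1, m[ are square summable, because
the normalising factors of the amalgam norm amount to powers of [s]; (3) the
integral of [g ^+ 2] over [n - 1, n[ is O(n ^+ 2), uniformly in [n].

All the harmonic analysis rests on one formula: the Fejer kernel
[(sin (a t) / t) ^+ 2] has cosine transform [c * triangle a x], a triangle
supported in [-2 a, 2 a] ([fejer_cos]).  By homogeneity the kernel of parameter
[a] has mass [c * `|a|] ([fejer_massE]), where [c] is the mass for [a = 1], and
product-to-sum formulas turn the cosine transform into a second difference of
these masses.

(1) implies (2).  Multiply [g] by a triangle supported where [g] is square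
integrable and sample the sine transform of the product on the arithmetic
progression [n h] adapted to that support.  The samples are square summable by a
Bessel inequality ([bessel]).  On the other side a sample is the integral of
[s * F s] against a difference of two translated Fejer kernels, and at the
sampling points this difference, multiplied by [s], is a perfect square
([sample_kernelE]).  As [F >= 0], nothing cancels, and the sample dominates
[b_m] for every unit interval within [h / 2] of [n h] ([band_le_sample]).

(2) implies (3).  Damp [s * F s] by a factor decaying like [s ^- 3]; its sine
transform is then a genuine smoothing of [g] ([smoothedE]) and converges to [g]
almost everywhere by Lebesgue differentiation ([smoothed_cvg_ae]).  Integrate
the square of this smoothing against a Fejer kernel of width [n]: the resulting
quadratic form in [s * F s] only couples frequencies at distance less than 1, so
it is bounded by the sum of the [b_m ^+ 2] ([sine_energy]).  Fatou's lemma passes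
to the limit ([square_mass_le]).  The imaginary part of [f] has zero transform on
the half-line, so the same estimate, with all masses zero, shows that it
contributes nothing.

(3) implies (1) because [0, 1[ is a neighbourhood of 0. *)

(** * Real-valued integrable functions on the line *)

Section real_line.
Context {R : realType}.
Local Notation mu := (@lebesgue_measure R).
Local Notation Intg f := (mu.-integrable [set: R] (EFin \o f)).

Lemma Intg_measurable (f : R -> R) : Intg f -> measurable_fun [set: R] f.
Proof. by move=> /integrableP[/measurable_EFinP]. Qed.

Lemma Intg_le (f g : R -> R) : measurable_fun [set: R] f ->
  (forall x, `|f x| <= g x) -> Intg g -> Intg f.
Proof.
move=> mf fg; apply: le_integrable => //; first exact/measurable_EFinP.
by move=> x _ /=; rewrite lee_fin (le_trans (fg x))// ler_norm.
Qed.

Lemma IntgD (f g : R -> R) : Intg f -> Intg g -> Intg (fun x => f x + g x).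
Proof. by move=> hf hg; exact: (integrableD measurableT hf hg). Qed.

Lemma IntgB (f g : R -> R) : Intg f -> Intg g -> Intg (fun x => f x - g x).
Proof. by move=> hf hg; exact: (integrableB measurableT hf hg). Qed.

Lemma IntgZ (k : R) (f : R -> R) : Intg f -> Intg (fun x => k * f x).
Proof. by move=> hf; exact: (integrableZl measurableT k hf). Qed.

Lemma Intg_abs (f : R -> R) : Intg f -> Intg (fun x => `|f x|).
Proof. exact: integrable_norm. Qed.

Lemma IntgM (k : R) (f b : R -> R) : measurable_fun [set: R] b ->
  (forall x, `|b x| <= k) -> Intg f -> Intg (fun x => f x * b x).
Proof.
move=> mb bk hf; apply: (@Intg_le _ (fun x => k * `|f x|)).
- by apply: measurable_funM => //; exact: Intg_measurable.
- by move=> x; rewrite normrM mulrC ler_wpM2r.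
- exact/IntgZ/Intg_abs.
Qed.

Lemma Intg_sum (I : Type) (s : seq I) (f : I -> R -> R) :
  (forall i, Intg (f i)) -> Intg (fun x => \sum_(i <- s) f i x).
Proof.
move=> hf; elim: s => [|i s ih].
  by under eq_fun do rewrite big_nil; exact: integrable0.
under eq_fun do rewrite big_cons; exact: IntgD.
Qed.

Lemma integral_sumR (I : Type) (s : seq I) (f : I -> R -> R) :
  (forall i, Intg (f i)) ->
  \int[mu]_x (\sum_(i <- s) f i x) = \sum_(i <- s) \int[mu]_x f i x.
Proof.
move=> hf; elim: s => [|i s ih].
  under eq_Rintegral do rewrite big_nil.
  by rewrite big_nil Rintegral_cst// mul0r.
under eq_Rintegral do rewrite big_cons.
by rewrite RintegralD// ?ih ?big_cons//; exact: Intg_sum.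
Qed.

Lemma integralDR (f g : R -> R) : Intg f -> Intg g ->
  \int[mu]_x (f x + g x) = \int[mu]_x f x + \int[mu]_x g x.
Proof. by move=> hf hg; rewrite RintegralD. Qed.

Lemma integralBR (f g : R -> R) : Intg f -> Intg g ->
  \int[mu]_x (f x - g x) = \int[mu]_x f x - \int[mu]_x g x.
Proof. by move=> hf hg; rewrite RintegralB. Qed.

Lemma integralZR (k : R) (f : R -> R) : Intg f ->
  \int[mu]_x (k * f x) = k * \int[mu]_x f x.
Proof. by move=> hf; rewrite RintegralZl. Qed.

Lemma le_integralR (f g : R -> R) : Intg f -> Intg g ->
  (forall x, f x <= g x) -> \int[mu]_x f x <= \int[mu]_x g x.
Proof. by move=> hf hg fg; apply: le_Rintegral => // x _; exact: fg. Qed.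

Lemma le_norm_integral (f g : R -> R) : Intg f -> Intg g ->
  (forall x, `|f x| <= g x) -> `|\int[mu]_x f x| <= \int[mu]_x g x.
Proof.
move=> hf hg fg; apply: (le_trans (le_normr_Rintegral measurableT hf)).
by apply: le_integralR => //; exact: Intg_abs.
Qed.

Lemma EFin_integral (f : R -> R) : Intg f ->
  (\int[mu]_x (f x)%:E = (\int[mu]_x f x)%:E)%E.
Proof. by move=> hf; rewrite /Rintegral fineK//; exact: integrable_fin_num. Qed.

(** * Changes of variable *)

Section measure_preserving.
Variables (T : R -> R) (mT : measurable_fun [set: R] T).
Hypothesis Tmu : forall A : set R, measurable A -> mu (T @^-1` A) = mu A.

Lemma ge0_integral_preserving (f : R -> \bar R) : measurable_fun [set: R] f ->
  (forall x, 0 <= f x)%E -> (\int[mu]_x f (T x) = \int[mu]_x f x)%E.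
Proof.
move=> mf f0.
transitivity (\int[pushforward mu (T : _ -> measurableTypeR R)]_x f x)%E.
  by rewrite ge0_integral_pushforward.
by apply: eq_measure_integral => A mA _; exact: Tmu.
Qed.

Lemma integral_preserving (f : R -> \bar R) : measurable_fun [set: R] f ->
  (\int[mu]_x f (T x) = \int[mu]_x f x)%E.
Proof.
move=> mf; rewrite integralE [RHS]integralE; congr (_ - _)%E.
- rewrite -(ge0_integral_preserving (measurable_funepos mf) (funepos_ge0 _)).
  by apply: eq_integral => x _; rewrite (_ : (fun _ => _) = f \o T)// funepos_comp.
- rewrite -(ge0_integral_preserving (measurable_funeneg mf) (funeneg_ge0 _)).
  by apply: eq_integral => x _; rewrite (_ : (fun _ => _) = f \o T)// funeneg_comp.
Qed.

Lemma Rintegral_preserving (f : R -> R) : measurable_fun [set: R] f ->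
  \int[mu]_x f (T x) = \int[mu]_x f x.
Proof.
move=> mf; rewrite /Rintegral.
by rewrite -(integral_preserving (f := fun x => (f x)%:E))//; exact/measurable_EFinP.
Qed.

Lemma Intg_preserving (f : R -> R) : Intg f -> Intg (fun x => f (T x)).
Proof.
move=> /integrableP[mf foo]; apply/integrableP; split.
  by apply: measurableT_comp mf mT.
rewrite (integral_preserving (f := fun x => `|(f x)%:E|%E))//.
exact: measurableT_comp.
Qed.

End measure_preserving.

Lemma measurable_affine (a b : R) : measurable_fun [set: R] (fun x => a * x + b).
Proof. by apply: measurable_funD => //; apply: measurable_funM. Qed.

(** Both sides are measures, and they agree on half-open intervals. *)
Lemma lebesgue_measure_affine (a b : R) (A : set R) : 0 < a -> measurable A ->
  (a%:E * mu ((fun x => (a * x + b)%R) @^-1` A) = mu A)%E.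
Proof.
move=> a0 mA.
pose T := (fun x => a * x + b) : measurableTypeR R -> measurableTypeR R.
have mT : measurable_fun setT T by exact: measurable_affine.
pose nu : {measure set (measurableTypeR R) -> \bar R} :=
  measure_function_pushforward__canonical__measure_function_Measure mu mT.
transitivity (mscale (NngNum (ltW a0)) nu A) => //.
apply/esym/lebesgue_measure_unique => // _ [[u v]] _ <- /=.
have nuE : nu `]u, v]%classic = mu `](u - b) / a, (v - b) / a]%classic.
  congr (mu _).
  apply/seteqP; split=> x /=; rewrite !in_itv/= /T;
  by rewrite ltr_pdivrMr// ler_pdivlMr// ltrBlDr lerBrDr [x * a]mulrC.
rewrite /mscale nuE !lebesgue_measure_itv/= !lte_fin ltr_pM2r ?invr_gt0// ltrD2r.
case: ifPn => _; last by rewrite mule0.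
by rewrite -!EFinB -EFinM; congr EFin; field; rewrite gt_eqF.
Qed.

Lemma ge0_integral_affine (a b : R) (f : R -> \bar R) : 0 < a ->
  measurable_fun [set: R] f -> (forall x, 0 <= f x)%E ->
  (a%:E * \int[mu]_x f (a * x + b)%R = \int[mu]_x f x)%E.
Proof.
move=> a0 mf f0.
pose T := (fun x => a * x + b) : measurableTypeR R -> measurableTypeR R.
have mT : measurable_fun setT T by exact: measurable_affine.
pose nu : {measure set (measurableTypeR R) -> \bar R} :=
  measure_function_pushforward__canonical__measure_function_Measure mu mT.
transitivity (\int[mscale (NngNum (ltW a0)) nu]_x f x)%E.
  by rewrite ge0_integral_mscale// ge0_integral_pushforward.
by apply: eq_measure_integral => A mA _; exact: lebesgue_measure_affine.
Qed.

Lemma measure_shift (b : R) (A : set R) : measurable A ->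
  mu ((fun x => x + b) @^-1` A) = mu A.
Proof.
move=> mA; rewrite -(@lebesgue_measure_affine 1 b A)// mul1e; congr (mu _).
by apply/funext => x /=; rewrite mul1r.
Qed.

Lemma measurable_shift (b : R) : measurable_fun [set: R] (fun x : R => x + b).
Proof. exact: measurable_funD. Qed.

Lemma measurable_opp : measurable_fun [set: R] (fun x : R => - x).
Proof. exact: measurableT_comp. Qed.

Definition integral_shift b := Rintegral_preserving (measurable_shift b) (@measure_shift b).
Definition Intg_shift b := Intg_preserving (measurable_shift b) (@measure_shift b).
Definition integral_opp := Rintegral_preserving measurable_opp (@lebesgue_measureN R).
Definition Intg_opp := Intg_preserving measurable_opp (@lebesgue_measureN R).

(** * Exchange of integrals *)

(** Fubini's theorem in the only form used below: two integrable densities and a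
bounded kernel, so that integrability on the plane is automatic. *)
Lemma integral_swap (p q : R -> R) (B : R -> R -> R) (M : R) :
  Intg p -> Intg q ->
  measurable_fun [set: R * R] (fun z => B z.1 z.2) ->
  (forall x y, `|B x y| <= M) ->
  \int[mu]_x (p x * \int[mu]_y (q y * B x y)) =
  \int[mu]_y (q y * \int[mu]_x (p x * B x y)).
Proof.
move=> hp hq mB BM.
have mBx x : measurable_fun [set: R] (B x).
  exact: (measurableT_comp mB (pair1_measurable x)).
have mBy y : measurable_fun [set: R] (B ^~ y).
  exact: (measurableT_comp mB (pair2_measurable y)).
have hqB x : Intg (fun y => q y * B x y) by exact: IntgM.
have hpB y : Intg (fun x => p x * B x y) by exact: IntgM.
have mp := Intg_measurable hp.
have mq := Intg_measurable hq.
pose F (z : R * R) := (p z.1 * q z.2 * B z.1 z.2)%:E.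
have mF : measurable_fun [set: R * R] F.
  apply/measurable_EFinP; apply: measurable_funM => //.
  by apply: measurable_funM; exact: measurableT_comp.
have iF : (mu \x mu)%E.-integrable [set: R * R] F.
  apply/(integrable12ltyP mu mu mF).
  have hq' : Intg (fun y => `|M| * `|q y|) by exact/IntgZ/Intg_abs.
  apply: (@le_lt_trans _ _ (\int[mu]_x ((`|p x| * \int[mu]_y (`|M| * `|q y|)))%:E)%E).
    apply: ge0_le_integral => //.
    - by move=> x _; exact: integral_ge0.
    - have mAF : measurable_fun [set: R * R] (abse \o F) by exact: measurableT_comp.
      exact: (@measurable_fun_fubini_tonelli_F _ _ _ _ _ mu _ mAF
        (fun z => abse_ge0 _)).
    - apply/measurable_EFinP; apply: measurable_funM => //.
      exact: Intg_measurable (Intg_abs hp).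
    move=> x _; rewrite EFinM -EFin_integral// -integralZl//.
    apply: ge0_le_integral => //.
    - have hx : measurable_fun [set: R] (fun y => (p x * q y * B x y)%:E).
        apply/measurable_EFinP/measurable_funM; last exact: mBx.
        exact: measurable_funM.
      exact: measurableT_comp hx.
    - by apply/measurable_EFinP; apply: measurable_funM => //;
        exact: Intg_measurable.
    move=> y _; rewrite lee_fin !normrM -mulrA ler_wpM2l// mulrC ler_wpM2r//.
    by rewrite (le_trans (BM x y))// ler_norm.
  rewrite [ltLHS]EFin_integral ?ltry//.
  under eq_fun do rewrite mulrC; exact/IntgZ/Intg_abs.
have := Fubini iF; rewrite /F /= /Rintegral => H.
transitivity (fine (\int[mu]_x (\int[mu]_y (p x * q y * B x y)%:E))%E).
  congr fine; apply: eq_integral => x _.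
  rewrite EFinM -EFin_integral// -integralZl//; last exact: hqB.
  by apply: eq_integral => y _; rewrite -EFinM mulrA.
congr fine; apply: (etrans H); apply: eq_integral => y _.
rewrite EFinM -EFin_integral// -integralZl//; last exact: hpB.
by apply: eq_integral => x _; rewrite -EFinM mulrCA mulrA.
Qed.

Lemma measurable_integral_kernel (p : R -> R) (B : R -> R -> R) :
  measurable_fun [set: R] p ->
  measurable_fun [set: R * R] (fun z => B z.1 z.2) ->
  measurable_fun [set: R] (fun s => \int[mu]_y (p y * B s y)).
Proof.
move=> mp mB.
pose f (z : R * R) := (p z.2 * B z.1 z.2)%:E.
have mf : measurable_fun [set: R * R] f.
  apply/measurable_EFinP; apply: measurable_funM => //.
  exact: (measurableT_comp mp measurable_snd).
(* The kernel need not be integrable on the plane: each of its positive and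
   negative parts is handled by Tonelli's theorem. *)
have mP := measurable_fun_fubini_tonelli_F (m2 := mu) _ (measurable_funepos mf) (funepos_ge0 f).
have mN := measurable_fun_fubini_tonelli_F (m2 := mu) _ (measurable_funeneg mf) (funeneg_ge0 f).
have mF : measurable_fun [set: R] (fun s => \int[mu]_y (p y * B s y)%:E)%E.
  apply: eq_measurable_fun (emeasurable_funB mP mN) => s _ /=.
  rewrite [RHS]integralE /fubini_F; congr (_ - _)%E; apply: eq_integral => y _.
  - by rewrite -[LHS]/((f^\+%E \o pair s) y) -funepos_comp.
  - by rewrite -[LHS]/((f^\-%E \o pair s) y) -funeneg_comp.
exact: (measurableT_comp (fine_measurable measurableT) mF).
Qed.

End real_line.

(** * The characters *)

Section characters.
Context {R : realType}.
Local Notation mu := (@lebesgue_measure R).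
Local Notation Intg f := (mu.-integrable [set: R] (EFin \o f)).
Implicit Types a b s t x y z : R.

Lemma norm_sin_le x : `|sin x| <= `|x|.
Proof.
wlog x0 : x / 0 <= x => [hw|].
  have [/hw//|x0] := leP 0 x.
  by have := hw (- x); rewrite sinN !normrN oppr_ge0 => /(_ (ltW x0)).
have [c _ ] := MVT_segment x0 (fun y _ => is_derive_sin y)
  (continuous_subspaceT (@continuous_sin R)).
rewrite sin0 !subr0 => ->; rewrite normrM ler_piMl//; exact: cos_max.
Qed.

Lemma cos_half x : cos x = 1 - 2 * sin (x / 2) ^+ 2.
Proof. by rewrite [in LHS](splitr x) cosD -!expr2 cos2sin2; ring. Qed.

(** On [0, 1] the derivative [cos] is at least 1/2, as [1 - cos x <= x ^+ 2 / 2]. *)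
Lemma sin_ge_half x : 0 <= x <= 1 -> x / 2 <= sin x.
Proof.
move=> /andP[x0 x1].
have [c /[!in_itv]/= /andP[c0 cx]] := MVT_segment x0 (fun y _ => is_derive_sin y)
  (continuous_subspaceT (@continuous_sin R)).
rewrite sin0 !subr0 => ->; rewrite mulrC ler_wpM2r// cos_half.
have : sin (c / 2) ^+ 2 <= (c / 2) ^+ 2.
  by rewrite -[leLHS]real_normK ?num_real// -[leRHS]real_normK ?num_real//
    lerXn2r ?nnegrE//; exact: norm_sin_le.
have : (c / 2) ^+ 2 <= (1 / 2) ^+ 2.
  by rewrite lerXn2r ?nnegrE ?divr_ge0// ler_wpM2r// (le_trans cx).
by lra.
Qed.

Lemma mul_phi x y : x * y * phi x y = sin (x * y).
Proof.
rewrite /phi; case: ifPn => [/eqP ->|xy0]; first by rewrite mul0r sin0.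
by rewrite mulrC divfK.
Qed.

Lemma phiC x y : phi x y = phi y x.
Proof. by rewrite /phi mulrC. Qed.

Lemma phiN x y : phi x (- y) = phi x y.
Proof. by rewrite /phi mulrN oppr_eq0 sinN invrN mulrNN. Qed.

Lemma phiNl x y : phi (- x) y = phi x y.
Proof. by rewrite phiC phiN phiC. Qed.

Lemma phi0 y : phi 0 y = 1.
Proof. by rewrite /phi mul0r eqxx. Qed.

Lemma phi_le1 x y : `|phi x y| <= 1.
Proof.
rewrite /phi; case: ifPn => [_|xy0]; first by rewrite normr1.
by rewrite normrM normfV ler_pdivrMr ?normr_gt0// mul1r norm_sin_le.
Qed.

Lemma phi_ge_half x y : `|x * y| <= 1 -> 2^-1 <= phi x y.
Proof.
move=> xy1; suff -> : phi x y = phi 1 `|x * y|.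
  rewrite /phi mul1r; case: ifPn => [_|xy0]; first by lra.
  rewrite ler_pdivlMr ?lt_neqAle ?normr_ge0 ?(eq_sym 0) ?xy0//.
  by rewrite mulrC sin_ge_half// normr_ge0.
rewrite /phi mul1r normr_eq0; case: ifPn => // xy0.
have [?|?] := leP 0 (x * y); first by rewrite ger0_norm.
by rewrite ltr0_norm// sinN invrN mulrNN.
Qed.

Lemma measurable_sin : measurable_fun [set: R] (@sin R).
Proof. by apply: continuous_measurable_fun; exact: continuous_sin. Qed.

Lemma measurable_cos : measurable_fun [set: R] (@cos R).
Proof. by apply: continuous_measurable_fun; exact: continuous_cos. Qed.

(** The inverse is continuous off the origin, and a point is harmless. *)
Lemma measurable_inv : measurable_fun [set: R] (fun x : R => x^-1).
Proof.
have mN : measurable [set~ (0 : R)] by exact/measurableC.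
rewrite -(setUv [set (0 : R)]); apply/measurable_funU => //; split.
  exact: measurable_fun_set1.
apply: open_continuous_measurable_fun; first exact/closed_openC.
by move=> x /[!inE]/= /eqP x0; exact: inv_continuous.
Qed.

Lemma measurable_phi1 : measurable_fun [set: R] (@phi R 1).
Proof.
rewrite (_ : phi 1 = fun x => if x == 0 then 1 else sin x * x^-1); last first.
  by apply/funext => x; rewrite /phi mul1r.
apply: measurable_fun_ifT => //; first exact: measurable_fun_eqr.
exact: measurable_funM measurable_sin measurable_inv.
Qed.

Lemma measurable_phi_comp d (T : measurableType d) (f g : T -> R) :
  measurable_fun [set: T] f -> measurable_fun [set: T] g ->
  measurable_fun [set: T] (fun w => phi (f w) (g w)).
Proof.
move=> mf mg; have -> : (fun w => phi (f w) (g w)) = phi 1 \o (fun w => f w * g w).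
  by apply/funext => w; rewrite /phi /= mul1r.
exact: (measurableT_comp measurable_phi1 (measurable_funM mf mg)).
Qed.

(** * The Fejer kernels *)

(** This is [sin (a * t) / t], with value [a] at [t = 0]; its square is the Fejer
kernel. *)
Definition fejer_root (a t : R) := a * phi a t.
Local Notation r := fejer_root.

Lemma mul_fejer_root a t : t * r a t = sin (a * t).
Proof. by rewrite /r -mul_phi; ring. Qed.

Lemma fejer_rootN a t : r a (- t) = r a t.
Proof. by rewrite /r phiN. Qed.

Lemma fejer_root_le a t : `|r a t| <= `|a|.
Proof. by rewrite /r normrM ler_piMr// phi_le1. Qed.

Lemma fejer_root_ge a t : 0 <= a -> `|a * t| <= 1 -> a / 2 <= r a t.
Proof. by move=> a0 at1; rewrite ler_wpM2l// phi_ge_half. Qed.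

Lemma measurable_fejer_root a : measurable_fun [set: R] (r a).
Proof. by apply: measurable_funM => //; exact: measurable_phi_comp. Qed.

Lemma in_halfline x : (x \in halfline R) = (0 <= x).
Proof. by apply/idP/idP; rewrite inE /halfline/= in_itv/= andbT. Qed.

Lemma Intg_oneDsqrV : Intg (fun t => (1 + t ^+ 2)^-1).
Proof.
pose v t := (1 + t ^+ 2)^-1 : R.
have mv : measurable_fun [set: R] v.
  by apply: continuous_measurable_fun; exact: continuous_oneDsqrV.
have v0 t : 0 <= v t by rewrite invr_ge0 addr_ge0// sqr_ge0.
have mI : measurable (halfline R) by exact: measurable_itv.
pose vp := v \_ (halfline R).
have hvp : Intg vp.
  suff : mu.-integrable (halfline R) (EFin \o v).
    by move=> /(integrable_mkcond (mu := mu) (EFin \o v) mI).1; rewrite restrict_EFin.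
  apply/integrableP; split; first exact/measurable_EFinP/measurable_funTS.
  under eq_integral do rewrite /= ger0_norm//.
  by rewrite integral0y_oneDsqr ltry.
apply: (@Intg_le _ _ (fun t => vp t + vp (- t))) => //; last first.
  by apply: IntgD => //; exact: (Intg_opp hvp).
have vp0 t : 0 <= vp t by rewrite /vp patchE; case: ifP.
move=> t; rewrite ger0_norm ?v0//; have [t0|t0] := leP 0 t.
  by apply: ler_wpDr => //; rewrite /vp patchE in_halfline t0.
apply: ler_wpDl => //; rewrite /vp patchE in_halfline oppr_ge0 (ltW t0).
by rewrite /v sqrrN.
Qed.

(** The square of [sin (a t) / t] is at most [a ^+ 2] and at most [1 / t ^+ 2]. *)
Lemma Intg_fejer a : Intg (fun t => r a t ^+ 2).
Proof.
apply: (@Intg_le _ _ (fun t => (a ^+ 2 + 1) * (1 + t ^+ 2)^-1)).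
- by apply: measurable_funX; exact: measurable_fejer_root.
- move=> t; rewrite ger0_norm ?sqr_ge0// ler_pdivlMr; last first.
    by rewrite ltr_pwDl// sqr_ge0.
  rewrite mulrDr mulr1 -exprMn [r a t * t]mulrC mul_fejer_root lerD//.
  rewrite -[leLHS]real_normK ?num_real// -[leRHS]real_normK ?num_real//.
  by rewrite lerXn2r ?nnegrE//; exact: fejer_root_le.
- exact/IntgZ/Intg_oneDsqrV.
Qed.

Definition fejer_mass : R := \int[mu]_t (r 1 t ^+ 2).
Local Notation c := fejer_mass.

(** Substituting [a * t] for [t] scales the kernel of parameter 1 to the kernel of
parameter [a]. *)
Lemma fejer_massE a : \int[mu]_t (r a t ^+ 2) = c * `|a|.
Proof.
wlog a0 : a / 0 <= a => [hw|].
  have [/hw//|a0] := leP 0 a.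
  have {hw}/hw : 0 <= - a by rewrite oppr_ge0 ltW.
  by rewrite normrN => <-; apply: eq_Rintegral => t _; rewrite /r phiNl mulNr sqrrN.
move: a0; rewrite le_eqVlt => /predU1P[<-|a0].
  rewrite normr0 mulr0; under eq_Rintegral do rewrite /r mul0r expr0n/=.
  by rewrite Rintegral_cst// mul0r.
rewrite gtr0_norm//; apply: EFin_inj.
rewrite -EFin_integral; last exact: Intg_fejer.
rewrite mulrC EFinM -(EFin_integral (Intg_fejer 1)).
pose K t := (r 1 t ^+ 2)%:E.
have mK : measurable_fun [set: R] K.
  apply/measurable_EFinP; apply: measurable_funX; exact: measurable_fejer_root.
have K0 t : (0 <= K t)%E by rewrite lee_fin sqr_ge0.
rewrite -(ge0_integral_affine 0 a0 mK K0) muleA -EFinM -integralZl//; last first.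
  have /measurable_EFinP mK' := measurableT_comp mK (measurable_affine a 0).
  apply: (@Intg_le _ _ (fun t => (a^-1) ^+ 2 * r a t ^+ 2)) => //.
    move=> t; rewrite ger0_norm ?sqr_ge0// -exprMn /r /phi !mul1r addr0 mulrA.
    by rewrite mulVf ?mul1r// gt_eqF.
  exact/IntgZ/Intg_fejer.
apply: eq_integral => t _.
by rewrite /K -EFinM /r /phi !mul1r addr0 -expr2 -exprMn.
Qed.

Lemma fejer_mass_gt0 : 0 < c.
Proof.
have mI : measurable (`[0, 1]%classic : set R) by exact: measurable_itv.
have h1 : Intg (\1_(`[0, 1]%classic : set R)) by exact: integrable_indic_itv.
have : \int[mu]_t (4^-1 * \1_(`[0, 1]%classic : set R) t) <= c.
  apply: le_integralR; [exact: IntgZ|exact: Intg_fejer|move=> t].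
  rewrite indicE; case: (boolP (_ \in _)); last by rewrite mulr0 sqr_ge0.
  rewrite inE/= in_itv/= => /andP[t0 t1]; rewrite mulr1.
  have : 1 / 2 <= r 1 t by apply: fejer_root_ge; rewrite ?mul1r ?ger0_norm.
  by nra.
apply: lt_le_trans; rewrite integralZR// /Rintegral integral_indic//.
have h : lebesgue_measure (`[0, 1]%classic : set R) = 1%:E.
  by rewrite lebesgue_measure_itv/= lte_fin ltr01 oppr0 adde0.
rewrite setIT (_ : fine _ = 1); last exact: (congr1 fine h).
by rewrite mulr1 invr_gt0.
Qed.

(** For [a >= 0] this is [max 0 (a - `|x| / 2)].  It is written as a second
difference of the absolute value because this is how it comes out of the masses
of the Fejer kernels; [triangle_small] and [triangle_large] recover the
piecewise form. *)
Definition triangle (a x : R) := (`|a + x / 2| + `|a - x / 2|) / 2 - `|x / 2|.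

Lemma measurable_triangle a : measurable_fun [set: R] (triangle a).
Proof.
have mh : measurable_fun [set: R] (fun x : R => x / 2) by exact: measurable_funM.
apply: measurable_funB; last exact: (measurableT_comp (@normr_measurable _ setT)).
apply: measurable_funM => //; apply: measurable_funD.
  by apply: (measurableT_comp (@normr_measurable _ setT)); exact: measurable_funD.
by apply: (measurableT_comp (@normr_measurable _ setT)); exact: measurable_funB.
Qed.

Lemma triangleN a x : triangle a (- x) = triangle a x.
Proof. by rewrite /triangle mulNr opprK normrN addrC (addrC `|a - _|) addrC. Qed.

Lemma triangle_ge0 a x : 0 <= triangle a x.
Proof.
have := ler_normB (a + x / 2) (a - x / 2).
rewrite (_ : a + x / 2 - (a - x / 2) = x / 2 + x / 2); last by field.
by rewrite -mulr2n normrMn /triangle; lra.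
Qed.

Lemma triangle_small a x : `|x| <= 2 * a -> triangle a x = a - `|x| / 2.
Proof.
move=> xa; have /andP[h1 h2] : - (2 * a) <= x <= 2 * a by rewrite -ler_norml.
by rewrite /triangle (ger0_norm (x := a + _)) 1?(ger0_norm (x := a - _)) ?normrM
  ?(ger0_norm (x := 2^-1)) ; lra.
Qed.

Lemma triangle_large a x : 0 <= a -> 2 * a <= `|x| -> triangle a x = 0.
Proof.
move=> a0; have [x0|x0] := leP 0 x.
  rewrite (ger0_norm x0) => xa.
  rewrite /triangle (ger0_norm (x := a + _)) ?(ler0_norm (x := a - _)) ?(ger0_norm (x := x / 2)); lra.
rewrite (ltr0_norm x0) => xa.
rewrite /triangle (ler0_norm (x := a + _)) ?(ger0_norm (x := a - _)) ?(ler0_norm (x := x / 2)); lra.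
Qed.

Lemma triangle_le a x : 0 <= a -> triangle a x <= a.
Proof.
move=> a0; have [xa|/ltW xa] := leP `|x| (2 * a); last by rewrite triangle_large.
by rewrite triangle_small// gerBl divr_ge0.
Qed.

(** The product [sin ^+ 2 * cos] is a combination of squares of sines, so that
multiplying a Fejer kernel by a cosine gives a combination of Fejer kernels. *)
Lemma fejer_cosE a x t : r a t ^+ 2 * cos (x * t) =
  2^-1 * r (a + x / 2) t ^+ 2 + 2^-1 * r (a - x / 2) t ^+ 2 - r (x / 2) t ^+ 2.
Proof.
have [->|t0] := eqVneq t 0.
  by rewrite /r !(phiC _ 0) !phi0 mulr0 cos0; field.
apply: (mulfI (expf_neq0 2 t0)).
rewrite mulrA !(mulrDr, mulrN) ![_ * (2^-1 * _)]mulrCA -!exprMn !mul_fejer_root.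
rewrite mulrDl mulrBl sinD sinB (_ : x * t = x / 2 * t + x / 2 * t); last by field.
rewrite cosD -!expr2 (_ : sin (a * t) ^+ 2 * _ = sin (a * t) ^+ 2 *
  cos (x / 2 * t) ^+ 2 - (1 - cos (a * t) ^+ 2) * sin (x / 2 * t) ^+ 2); last first.
  by rewrite -sin2cos2; ring.
by field.
Qed.

(** Integrate [fejer_cosE] and use that the mass is proportional to the absolute value
of the parameter. *)
Lemma fejer_cos a x : \int[mu]_t (r a t ^+ 2 * cos (x * t)) = c * triangle a x.
Proof.
have hK b k := IntgZ k (Intg_fejer b).
under eq_Rintegral do rewrite fejer_cosE.
rewrite integralBR ?integralDR ?integralZR ?fejer_massE; first by rewrite /triangle; field.
all: by [exact: Intg_fejer|exact: IntgD|exact: hK].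
Qed.

Lemma measurable_mulr a : measurable_fun [set: R] ( *%R a).
Proof. exact: measurable_funM. Qed.

Lemma Intg_fejer_cos a x : Intg (fun t => r a t ^+ 2 * cos (x * t)).
Proof.
apply: (@IntgM _ 1); last exact: Intg_fejer.
  exact: (measurableT_comp measurable_cos (measurable_mulr x)).
by move=> t; exact: cos_max.
Qed.

Lemma fejer_sin_sin a x y :
  \int[mu]_t (r a t ^+ 2 * (sin (x * t) * sin (y * t))) =
  c / 2 * (triangle a (x - y) - triangle a (x + y)).
Proof.
rewrite (_ : (fun _ => _) = fun t => 2^-1 * (r a t ^+ 2 * cos ((x - y) * t) -
  r a t ^+ 2 * cos ((x + y) * t))); last first.
  by apply/funext => t; rewrite mulrBl mulrDl cosB cosD; field.
have h z := Intg_fejer_cos a z.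
rewrite integralZR ?integralBR ?fejer_cos//; first by field.
exact: IntgB.
Qed.

End characters.

(** * The transform of a density *)

Section transform.
Context {R : realType}.
Local Notation mu := (@lebesgue_measure R).
Local Notation Intg f := (mu.-integrable [set: R] (EFin \o f)).
Local Notation r := fejer_root.
Local Notation c := (@fejer_mass R).
Implicit Types a b s t x y z : R.

(** The Fourier transform on the half-line of [f], once [x ^+ 2] is absorbed into
the density [p]. *)
Definition transform (p : R -> R) (s : R) := \int[mu]_y (p y * phi s y).

Lemma measurable_transform (p : R -> R) :
  measurable_fun [set: R] p -> measurable_fun [set: R] (transform p).
Proof.
move=> mp; apply: measurable_integral_kernel => //.
exact: (measurable_phi_comp measurable_fst measurable_snd).
Qed.

Lemma Intg_phi (p : R -> R) s : Intg p -> Intg (fun y => p y * phi s y).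
Proof.
move=> hp; apply: (@IntgM _ 1) => //; first exact: measurable_phi_comp.
by move=> y; exact: phi_le1.
Qed.

Lemma Intg_phi_l (q : R -> R) x : Intg q -> Intg (fun s => q s * phi s x).
Proof. by move=> /(Intg_phi x); under eq_fun do rewrite phiC. Qed.

Lemma transform_le (p : R -> R) s : Intg p ->
  `|transform p s| <= \int[mu]_y `|p y|.
Proof.
move=> hp; apply: le_norm_integral; [exact: Intg_phi|exact: Intg_abs|move=> y].
by rewrite normrM ler_piMr// phi_le1.
Qed.

Lemma transformN (p : R -> R) s : transform p (- s) = transform p s.
Proof. by apply: eq_Rintegral => y _; rewrite phiNl. Qed.

Lemma Intg_mul_transform (p q : R -> R) : Intg p -> Intg q ->
  Intg (fun s => q s * transform p s).
Proof.
move=> hp hq; apply: (@IntgM _ (\int[mu]_y `|p y|)) => //.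
  by apply: measurable_transform; exact: Intg_measurable.
by move=> s; exact: transform_le.
Qed.

Lemma integral_mul_transform (p q : R -> R) : Intg p -> Intg q ->
  \int[mu]_s (q s * transform p s) = \int[mu]_x (p x * \int[mu]_s (q s * phi s x)).
Proof.
move=> hp hq; apply: (@integral_swap _ q p (fun s x => phi s x) 1) => //.
  exact: (measurable_phi_comp measurable_fst measurable_snd).
by move=> s x; exact: phi_le1.
Qed.

(** * Sampling *)

Lemma integral_odd (f : R -> R) : measurable_fun [set: R] f ->
  (forall x, f (- x) = - f x) -> Intg f -> \int[mu]_x f x = 0.
Proof.
move=> mf fN hf; have := integral_opp mf.
under eq_Rintegral do rewrite fN -mulN1r.
by rewrite integralZR// mulN1r => /eqP; rewrite eq_sym -addr_eq0 -mulr2n mulrn_eq0 => /eqP.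
Qed.

(** Translating by [b] and expanding the sine of a sum, only the term with
[sin (b * x)] is even in the integration variable. *)
Lemma fejer_shift_sin a b x :
  \int[mu]_s (r a (s - b) ^+ 2 * sin (s * x)) = c * triangle a x * sin (b * x).
Proof.
have msin : measurable_fun [set: R] (fun s => sin (s * x)).
  by apply: (measurableT_comp measurable_sin); exact: measurable_funM.
have hs : Intg (fun s => r a s ^+ 2 * sin (x * s)).
  apply: (@IntgM _ 1); [|by move=> s; exact: sin_max|exact: Intg_fejer].
  exact: (measurableT_comp measurable_sin (measurable_mulr x)).
have hc := Intg_fejer_cos a x.
transitivity (\int[mu]_s (cos (b * x) * (r a s ^+ 2 * sin (x * s)) +
    sin (b * x) * (r a s ^+ 2 * cos (x * s)))).
  rewrite -(integral_shift b); last first.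
    apply: measurable_funM => //; apply: measurable_funX.
    exact: (measurableT_comp (measurable_fejer_root a) (measurable_shift (- b))).
  apply: eq_Rintegral => s _; rewrite addrK mulrDl sinD [s * x]mulrC; ring.
rewrite integralDR ?integralZR ?fejer_cos//; try exact: IntgZ.
rewrite integral_odd ?mulr0 ?add0r//; first by ring.
- exact: Intg_measurable.
- by move=> s; rewrite fejer_rootN mulrN sinN mulrN.
Qed.

Definition sample_kernel a b s := r a (s - b) ^+ 2 - r a (s + b) ^+ 2.

Lemma sinDnpi (n : nat) x : sin (x + n%:R * pi) = (-1) ^+ n * sin x.
Proof.
elim: n => [|n ih]; first by rewrite mul0r addr0 expr0 mul1r.
by rewrite -natr1 mulrDl mul1r addrA sinDpi ih exprS; ring.
Qed.

(** At a sampling frequency [b] the sines of [a * (s - b)] and [a * (s + b)]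
agree up to the sign [(-1) ^+ n].  This makes the kernel, multiplied by [s], a
perfect square: it is nonnegative, and integrable although the two Fejer kernels
multiplied by [s] are not. *)
Lemma sample_kernelE a b s (n : nat) : 2 * a * b = n%:R * pi ->
  s * sample_kernel a b s = b * (r a (s - b) + (-1) ^+ n * r a (s + b)) ^+ 2.
Proof.
move=> abn; rewrite /sample_kernel.
have : (s + b) * r a (s + b) = (-1) ^+ n * ((s - b) * r a (s - b)).
  by rewrite !mul_fejer_root -sinDnpi -abn; congr sin; ring.
have : (-1) ^+ n * (-1) ^+ n = 1 :> R by rewrite -expr2 sqrr_sign.
set e := (-1) ^+ n; set A := r a (s - b); set B := r a (s + b) => ee eAB.
apply/eqP; rewrite -subr_eq0; apply/eqP.
(* Each bracket vanishes by [eAB], up to a factor [1 - e * e]; [b] is half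
   the difference of [s + b] and [s - b]. *)
transitivity (A * ((s - b) * A - e * ((s + b) * B)) - B * ((s + b) * B - e * ((s - b) * A))
  + b * B ^+ 2 * (1 - e * e)); first by ring.
by rewrite eAB mulrA ee mul1r !subrr !mulr0 subr0 addr0.
Qed.

Lemma Intg_mul_sample_kernel a b (n : nat) : 0 <= b -> 2 * a * b = n%:R * pi ->
  Intg (fun s => s * sample_kernel a b s).
Proof.
move=> b0 abn.
have mr d : measurable_fun [set: R] (fun s => r a (s + d)).
  exact: (measurableT_comp (measurable_fejer_root a) (measurable_shift d)).
apply: (@Intg_le _ _ (fun s => 2 * b * (r a (s - b) ^+ 2 + r a (s + b) ^+ 2))).
- apply: measurable_funM => //.
  by apply: measurable_funB; apply: measurable_funX; exact: mr.
- move=> s; rewrite (sample_kernelE s abn) (ger0_norm (mulr_ge0 b0 (sqr_ge0 _))).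
  rewrite [2 * b]mulrC -mulrA ler_wpM2l//.
  have : (-1) ^+ n * (-1) ^+ n = 1 :> R by rewrite -expr2 sqrr_sign.
  set e := (-1) ^+ n; set A := r a (s - b); set B := r a (s + b) => ee.
  have -> : (A + e * B) ^+ 2 = A ^+ 2 + B ^+ 2 * (e * e) + 2 * (A * (e * B)) by ring.
  have := sqr_ge0 (A - e * B).
  have -> : (A - e * B) ^+ 2 = A ^+ 2 + B ^+ 2 * (e * e) - 2 * (A * (e * B)) by ring.
  by rewrite ee; lra.
- have hK d := Intg_shift d (Intg_fejer a).
  exact: (IntgZ _ (IntgD (hK (- b)) (hK b))).
Qed.

(** By [integral_swap] this turns the integral of [s * F s] against the sampling
kernel into a sine coefficient, at frequency [b], of [g] cut off by a triangle. *)
Lemma sample_kernel_phi a b (n : nat) x : 0 <= b -> 2 * a * b = n%:R * pi ->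
  x * \int[mu]_s (s * sample_kernel a b s * phi s x) =
  2 * c * triangle a x * sin (b * x).
Proof.
have hK d : Intg (fun s => r a (s + d) ^+ 2 * sin (s * x)).
  apply: (@IntgM _ 1); [|by move=> s; exact: sin_max|].
    by apply: (measurableT_comp measurable_sin); exact: measurable_funM.
  exact: (Intg_shift d (Intg_fejer a)).
move=> b0 abn.
rewrite -integralZR; last exact: Intg_phi_l (Intg_mul_sample_kernel b0 abn).
transitivity (\int[mu]_s (r a (s - b) ^+ 2 * sin (s * x) -
    r a (s - - b) ^+ 2 * sin (s * x))).
  apply: eq_Rintegral => s _.
  by rewrite -mulrBl opprK -/(sample_kernel a b s) -mul_phi; ring.
rewrite integralBR ?fejer_shift_sin//.
by rewrite mulNr sinN; ring.
Qed.

(** * The Bessel inequality *)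

(** On the support of [u] the kernel [w] of parameter [h / 4] is bounded below by
[h ^+ 2 / 64], while the sines [sin (n * h * x)] are orthogonal with respect to
[w x dx] because the corresponding triangle vanishes at the nonzero multiples of
[h].  So testing [u] against its own sine polynomial [P] bounds the coefficients. *)
Lemma bessel (u : R -> R) h (m : nat) : 0 < h -> Intg u -> Intg (fun x => u x ^+ 2) ->
  (forall x, pi / h < `|x| -> u x = 0) ->
  \sum_(1 <= n < m) (\int[mu]_x (u x * sin (n%:R * h * x))) ^+ 2 <=
  8 * c / h * \int[mu]_x (u x ^+ 2).
Proof.
move=> h0 hu hu2 uh.
pose S n := \int[mu]_x (u x * sin (n%:R * h * x)).
pose P x := \sum_(1 <= n < m) S n * sin (n%:R * h * x).
pose w x := r (h / 4) x ^+ 2.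
rewrite -/S; set Sig := \sum_(1 <= n < m) _.
have msin n : measurable_fun [set: R] (fun x => sin (n%:R * h * x)).
  exact: (measurableT_comp measurable_sin (measurable_mulr _)).
have hus n : Intg (fun x => u x * sin (n%:R * h * x)).
  by apply: (@IntgM _ 1) => // x; exact: sin_max.
have hw : Intg w by exact: Intg_fejer.
have hwss n k : Intg (fun x => w x * (sin (n%:R * h * x) * sin (k%:R * h * x))).
  apply: (@IntgM _ 1) => //; first exact: measurable_funM.
  by move=> x; rewrite normrM mulr_ile1// sin_max.
have uPE x : u x * P x = \sum_(1 <= n < m) S n * (u x * sin (n%:R * h * x)).
  by rewrite /P big_distrr/=; apply: eq_bigr => n _; ring.
have wPE x : w x * P x ^+ 2 = \sum_(1 <= n < m) \sum_(1 <= k < m)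
    S n * S k * (w x * (sin (n%:R * h * x) * sin (k%:R * h * x))).
  rewrite expr2 /P big_distrlr/= big_distrr/=; apply: eq_bigr => n _.
  by rewrite big_distrr/=; apply: eq_bigr => k _; ring.
have huP : Intg (fun x => u x * P x).
  under eq_fun do rewrite uPE.
  by apply: Intg_sum => n; exact/IntgZ/hus.
have hwP : Intg (fun x => w x * P x ^+ 2).
  under eq_fun do rewrite wPE.
  by apply: Intg_sum => n; apply: Intg_sum => k; exact/IntgZ/hwss.
have SigE : \int[mu]_x (u x * P x) = Sig.
  under eq_Rintegral do rewrite uPE.
  rewrite integral_sumR; last by move=> n; exact/IntgZ/hus.
  by apply: eq_bigr => n _; rewrite integralZR// expr2.
have wPint : \int[mu]_x (w x * P x ^+ 2) = c * h / 8 * Sig.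
  under eq_Rintegral do rewrite wPE.
  rewrite integral_sumR; last by move=> n; apply: Intg_sum => k; exact/IntgZ/hwss.
  rewrite big_distrr/=; apply: eq_big_nat => n /andP[n1 nm].
  rewrite integral_sumR; last by move=> k; exact/IntgZ/hwss.
  have wss k : (0 < k)%N -> \int[mu]_x (S n * S k * (w x * (sin (n%:R * h * x) *
      sin (k%:R * h * x)))) = if k == n then c * h / 8 * S n ^+ 2 else 0.
    move=> k0; rewrite integralZR// fejer_sin_sin.
    have h4 : 0 <= h / 4 by rewrite divr_ge0// ltW.
    have far j : 1 <= j -> triangle (h / 4) (j * h) = 0.
      move=> j1; rewrite triangle_large// ger0_norm ?mulr_ge0 ?(ltW h0)//; first by nra.
      exact: le_trans j1.
    rewrite -mulrDl -mulrBl (far (n%:R + k%:R)); last by rewrite -natrD ler1n ltn_addl.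
    case: ifPn => [/eqP ->|kn].
      by rewrite subrr mul0r triangle_small ?normr0//; [field|lra].
    have [nk|nk] : (n < k)%N \/ (k < n)%N by move: kn; rewrite neq_ltn => /orP[]; auto.
      rewrite -triangleN -mulNr opprB far ?subr0 ?mulr0//.
      by rewrite lerBrDr addrC natr1 ler_nat.
    rewrite far ?subr0 ?mulr0//.
    by rewrite lerBrDr addrC natr1 ler_nat.
  rewrite (eq_big_nat _ _ (F2 := fun k => if k == n then c * h / 8 * S n ^+ 2 else 0)); last first.
    by move=> k /andP[k1 _]; exact: wss.
  rewrite -big_mkcond/= big_nat1_eq n1 nm//.
(* The weights are chosen so that [u * P <= (4 c / h) u ^+ 2 + h / (16 c) P ^+ 2]
   and the last term contributes exactly half of [Sig]. *)
have key : Sig <= (4 * c / h) * \int[mu]_x (u x ^+ 2) + 4 * (c * h)^-1 * (c * h / 8 * Sig).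
  rewrite -wPint -SigE -(integralZR _ hu2) -(integralZR _ hwP) -integralDR; [|exact: IntgZ..].
  apply: le_integralR => //; first by apply: IntgD; exact: IntgZ.
  have c0 := @fejer_mass_gt0 R.
  move=> x; have [xh|xh] := ltP (pi / h) `|x|.
    rewrite uh// mul0r expr0n/= mulr0 add0r mulr_ge0//.
      by rewrite mulr_ge0// invr_ge0 mulr_ge0// ltW.
    by rewrite mulr_ge0// sqr_ge0.
  have rge : h / 8 <= r (h / 4) x.
    have := @fejer_root_ge _ (h / 4) x; rewrite (_ : h / 4 / 2 = h / 8); last by field.
    apply; first by rewrite divr_ge0// ltW.
    rewrite normrM ger0_norm ?divr_ge0 ?(ltW h0)//.
    have := @pihalf_lt2 R; move: xh; rewrite ler_pdivlMr//.
    by nra.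
  have wge : h ^+ 2 / 64 <= w x by rewrite /w; nra.
  have : 4 * (c * h)^-1 * (h ^+ 2 / 64 * P x ^+ 2) <= 4 * (c * h)^-1 * (w x * P x ^+ 2).
    rewrite ler_wpM2l ?mulr_ge0 ?invr_ge0 ?mulr_ge0 ?(ltW h0) ?(ltW c0)//.
    by rewrite ler_wpM2r ?sqr_ge0.
  move=> le1; rewrite -lerBlDl; apply: le_trans le1; rewrite lerBlDl.
  rewrite -subr_ge0.
  rewrite (_ : _ - _ = (8 * c * u x - h * P x) ^+ 2 / (16 * (c * h))); last first.
    by field; rewrite (gt_eqF c0) (gt_eqF h0).
  by rewrite divr_ge0 ?sqr_ge0 ?mulr_ge0 ?(ltW h0) ?(ltW c0).
have c0 := @fejer_mass_gt0 R.
have e : 4 * (c * h)^-1 * (c * h / 8 * Sig) = Sig / 2.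
  by field; rewrite (gt_eqF c0) (gt_eqF h0).
by rewrite e in key; lra.
Qed.

End transform.

(** * Local square integrability controls the bands *)

Section local_square_integrability.
Context {R : realType}.
Local Notation mu := (@lebesgue_measure R).
Local Notation Intg f := (mu.-integrable [set: R] (EFin \o f)).
Local Notation r := fejer_root.
Local Notation c := (@fejer_mass R).
Implicit Types a b s t x y z : R.

Lemma Intg_patch_unit_itv (f : R -> R) (M : R) (m : nat) :
  measurable_fun [set: R] f -> (forall s, s \in unit_itv R m -> `|f s| <= M) ->
  Intg (f \_ (unit_itv R m)).
Proof.
move=> mf fM; have mI : measurable (unit_itv R m) by exact: measurable_itv.
apply: (@Intg_le _ _ (fun s => M * \1_(unit_itv R m) s)).
- exact: ((measurable_restrictT f mI).1 (measurable_funTS mf)).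
- move=> s; rewrite patchE indicE; case: ifPn => sm; last by rewrite normr0 mulr0.
  by rewrite mulr1 fM.
- by apply: IntgZ; exact: integrable_indic_itv.
Qed.

Lemma in_unit_itv m s : (s \in unit_itv R m) = (m%:R - 1 <= s < m%:R).
Proof. by apply/idP/idP; rewrite inE /unit_itv/= in_itv. Qed.

Lemma sum_blocks (f : nat -> R) (q m : nat) : (0 < q)%N ->
  \sum_(0 <= j < m * q) f (j %/ q)%N = q%:R * \sum_(0 <= n < m) f n.
Proof.
move=> q0; elim: m => [|m ih]; first by rewrite mul0n !big_geq// mulr0.
rewrite mulSnr (@big_cat_nat _ _ _ (m * q))//= ?leq_addr// ih.
rewrite big_nat_recr//= mulrDr; congr (_ + _).
rewrite -{1}[(m * q)%N]add0n big_addn addKn.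
rewrite (eq_big_nat _ _ (F2 := fun=> f m)); last first.
  by move=> j /andP[_ jq]; rewrite addnC divnMDl// divn_small// addn0.
by rewrite sumr_const_nat subn0 mulr_natl.
Qed.

(** The identity [(s + b) * r a (s + b) = +- (s - b) * r a (s - b)] shows that
the second Fejer kernel is at most 1/9 of the first when [s + b] is three times
larger than [`|s - b|]. *)
Lemma sample_kernel_ge a b s (n : nat) : 0 < a -> 2 * a * b = n%:R * pi ->
  `|a * (s - b)| <= 1 -> 3 * `|s - b| <= s + b -> 0 < s + b ->
  2 / 9 * a ^+ 2 <= sample_kernel a b s.
Proof.
move=> a0 abn h1 h2 h3; rewrite /sample_kernel.
have := fejer_root_ge (ltW a0) h1.
have : ((s + b) * r a (s + b)) ^+ 2 = ((s - b) * r a (s - b)) ^+ 2.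
  have -> : (s + b) * r a (s + b) = (-1) ^+ n * ((s - b) * r a (s - b)).
    by rewrite !mul_fejer_root -sinDnpi -abn; congr sin; ring.
  by rewrite exprMn sqrr_sign mul1r.
have h4 : 9 * (s - b) ^+ 2 <= (s + b) ^+ 2.
  rewrite -[(s - b) ^+ 2]real_normK ?num_real//.
  by have := normr_ge0 (s - b); nra.
set A := r a (s - b); set B := r a (s + b) => eAB Age.
have BA : 9 * B ^+ 2 <= A ^+ 2.
  have h5 : 0 < (s + b) ^+ 2 by rewrite exprn_gt0.
  rewrite -(ler_pM2l h5) mulrCA -exprMn eAB exprMn mulrA ler_wpM2r ?sqr_ge0//.
have : a ^+ 2 / 4 <= A ^+ 2 by nra.
by lra.
Qed.

Variable p : R -> R.
Hypothesis hp : Intg p.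
Hypothesis p0 : forall x, x <= 0 -> p x = 0.
Hypothesis hat_ge0 : forall s, 0 <= s -> 0 <= transform p s.

Lemma integral_sample_kernel a b (n : nat) : 0 <= b -> 2 * a * b = n%:R * pi ->
  \int[mu]_s (s * sample_kernel a b s * transform p s) =
  \int[mu]_x (2 * c * triangle a x * (p x / x) * sin (b * x)).
Proof.
move=> b0 abn; rewrite integral_mul_transform//; last exact: Intg_mul_sample_kernel abn.
apply: eq_Rintegral => x _; have [->|x0] := eqVneq x 0.
  by rewrite p0// !(mul0r, mulr0).
have := sample_kernel_phi x b0 abn.
set I := \int[mu]_s _ => h; have -> : I = 2 * c * triangle a x * sin (b * x) / x.
  by rewrite -h mulrAC divff// mul1r.
by ring.
Qed.

Lemma sample_kernel_transform_ge0 a b (n : nat) s : 0 <= b ->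
  2 * a * b = n%:R * pi -> 0 <= s * sample_kernel a b s * transform p s.
Proof.
move=> b0 abn; rewrite mulr_ge0//.
  by rewrite (sample_kernelE s abn) mulr_ge0// sqr_ge0.
by have [s0|s0] := leP 0 s; [|rewrite -transformN]; apply: hat_ge0 => //; rewrite oppr_ge0 ltW.
Qed.

(** The mass on a unit interval of the sine transform of [p x / x]. *)
Definition band_mass (m : nat) := \int[mu]_(s in unit_itv R m) (s * transform p s).
Local Notation band := band_mass.

Lemma measurable_mul_transform : measurable_fun [set: R] (fun s => s * transform p s).
Proof.
by apply: measurable_funM => //; apply: measurable_transform; exact: Intg_measurable hp.
Qed.

Lemma Intg_band m : (0 < m)%N -> Intg ((fun s => s * transform p s) \_ (unit_itv R m)).
Proof.
move=> m0; apply: (@Intg_patch_unit_itv _ (m%:R * \int[mu]_y `|p y|)).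
  exact: measurable_mul_transform.
move=> s; rewrite in_unit_itv => /andP[ms sm].
rewrite normrM ler_pM//; last exact: transform_le.
rewrite ger0_norm ?(ltW sm)// (le_trans _ ms)// subr_ge0 ler1n//.
Qed.

Lemma band_ge0 m : (0 < m)%N -> 0 <= band m.
Proof.
move=> m0; apply: Rintegral_ge0 => s /mem_set; rewrite in_unit_itv => /andP[ms _].
have s0 : 0 <= s by rewrite (le_trans _ ms)// subr_ge0 ler1n.
by rewrite mulr_ge0// hat_ge0.
Qed.

(** Since the sampling kernel times [s] and the transform are nonnegative on the
whole line, the part of the integral over one unit interval is at most the whole
integral, which is a sample. *)
Lemma band_le_sample a b (n m : nat) : 0 < a -> 0 <= b -> 2 * a * b = n%:R * pi ->
  (0 < m)%N -> (forall s, s \in unit_itv R m ->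
    [/\ `|a * (s - b)| <= 1, 3 * `|s - b| <= s + b & 0 < s + b]) ->
  2 / 9 * a ^+ 2 * band m <=
  \int[mu]_x (2 * c * triangle a x * (p x / x) * sin (b * x)).
Proof.
move=> a0 b0 abn m0 hs; rewrite -(integral_sample_kernel b0 abn).
rewrite /band Rintegral_mkcond -(integralZR _ (Intg_band m0)).
apply: le_integralR.
- exact/IntgZ/Intg_band.
- exact/Intg_mul_transform/Intg_mul_sample_kernel/abn.
- move=> s; rewrite patchE; case: ifPn => sm; last first.
    by rewrite mulr0; exact: sample_kernel_transform_ge0 abn.
  have [h1 h2 h3] := hs _ sm.
  have s0 : 0 <= s.
    by move: sm; rewrite in_unit_itv => /andP[ms _]; rewrite (le_trans _ ms)// subr_ge0 ler1n.
  rewrite mulrA [leRHS]mulrC [leLHS]mulrC ler_wpM2l ?hat_ge0// mulrC ler_wpM2l//.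
  exact: sample_kernel_ge abn h1 h2 h3.
Qed.

(** With [h = 2 N] an even integer, the unit intervals beyond [N] split into blocks
of [2 N] centred at the multiples [n h], and all the bands of a block are
dominated by the same sample.  The integer [N] is taken so large that
[pi / h <= delta], the support of the triangle used for the samples. *)
Lemma sum_band_bounded (delta : R) : 0 < delta ->
  Intg (fun x => (p x / x) ^+ 2 * \1_(`[0, delta]%classic : set R) x) ->
  exists B : R, forall M : nat, \sum_(1 <= m < M) band m ^+ 2 <= B.
Proof.
move=> d0 hpx.
pose N := (Num.truncn (pi / delta)).+1.
pose h : R := (2 * N)%:R.
have N0 : (0 < N)%N by [].
have h0 : 0 < h by rewrite ltr0n.
have hd : pi / h <= delta.
  rewrite ler_pdivrMr// mulrC -ler_pdivrMr// /h natrM.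
  have : pi / delta < N%:R by rewrite truncnS_gt.
  have : 0 <= N%:R :> R by [].
  by lra.
pose a := pi / (2 * h).
have a0 : 0 < a by rewrite divr_gt0 ?pi_gt0// mulr_gt0.
have a2 : 2 * a = pi / h by rewrite /a; field; rewrite gt_eqF.
pose u x := 2 * c * triangle a x * (p x / x).
have c0 := @fejer_mass_gt0 R.
have u0 x : delta < `|x| -> u x = 0.
  move=> xd; rewrite /u triangle_large ?mulr0 ?mul0r// ?(ltW a0)// a2.
  by rewrite (le_trans hd) ?ltW.
have mpx : measurable_fun [set: R] (fun x => p x / x).
  exact: measurable_funM (Intg_measurable hp) measurable_inv.
have mu_ : measurable_fun [set: R] u.
  by apply: measurable_funM => //; apply: measurable_funM => //; exact: measurable_triangle.
have uneg x : x < 0 -> u x = 0 by move=> x0; rewrite /u p0 ?mul0r ?mulr0// ltW.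
have hu2 : Intg (fun x => u x ^+ 2).
  apply: (@Intg_le _ _ (fun x => (2 * c * a) ^+ 2 *
      ((p x / x) ^+ 2 * \1_(`[0, delta]%classic : set R) x))).
  - exact: measurable_funX.
  - move=> x; rewrite ger0_norm ?sqr_ge0// indicE.
    case: (boolP (x \in _)) => xd.
      rewrite mulr1 /u exprMn ler_wpM2r ?sqr_ge0//.
      have c2 : 0 <= 2 * c by rewrite mulr_ge0// ltW.
      have le1 : 2 * c * triangle a x <= 2 * c * a by rewrite ler_wpM2l// triangle_le// ltW.
      have le0 : 0 <= 2 * c * triangle a x by rewrite mulr_ge0// triangle_ge0.
      by rewrite lerXn2r ?nnegrE// (le_trans le0).
    rewrite mulr0 mulr0; suff -> : u x = 0 by rewrite expr0n.
    have [/uneg//|x0] := ltP x 0; apply: u0; rewrite ger0_norm//.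
    by rewrite ltNge; apply: contra xd => xd; rewrite inE/= in_itv/= x0.
  - exact: IntgZ.
have hu : Intg u.
  apply: (@Intg_le _ _ (fun x => u x ^+ 2 + \1_(`[0, delta]%classic : set R) x)) => //.
    move=> x; have [x0|x0] := ltP x 0.
      by rewrite uneg// normr0 addr_ge0 ?sqr_ge0.
    have [xd|xd] := ltP delta x.
      by rewrite u0 ?ger0_norm// normr0 addr_ge0 ?sqr_ge0.
    rewrite indicE mem_set/= ?in_itv/= ?x0// -real_normK ?num_real//.
    by have := sqr_ge0 (`|u x| - 1); have := normr_ge0 (u x); nra.
  by apply: IntgD => //; exact: integrable_indic_itv.
pose S (n : nat) := \int[mu]_x (u x * sin (n%:R * h * x)).
have uh x : pi / h < `|x| -> u x = 0.
  by move=> xh; rewrite /u triangle_large ?mulr0 ?mul0r// ?(ltW a0)// a2 ltW.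
pose D := 8 * c / h * \int[mu]_x (u x ^+ 2).
have hD m : \sum_(1 <= n < m) S n ^+ 2 <= D by exact: bessel.
pose k := (2 / 9 * a ^+ 2)^-1.
have k0 : 0 < k by rewrite invr_gt0 mulr_gt0// exprn_gt0.
(* The unit interval starting at [N + j] lies within [N] of [n h], where [n] is
   the index of the block containing [j]. *)
have bandS j : band (N + 1 + j) <= k * S (j %/ (2 * N)).+1.
  rewrite ler_pdivlMl; last by rewrite mulr_gt0// exprn_gt0.
  set n := (j %/ (2 * N)).+1.
  apply: (@band_le_sample a (n%:R * h) n) => //.
  - by rewrite mulr_ge0// ltW.
  - by rewrite /a; field; rewrite gt_eqF.
  move=> s; rewrite in_unit_itv => /andP[ms sm].
  have jn : (n.-1 * (2 * N) <= j < n * (2 * N))%N by rewrite leq_trunc_div ltn_ceil.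
  have [j1 j2] : (n%:R - 1) * h <= j%:R /\ j%:R + 1 <= n%:R * h.
    case/andP: jn => h1 h2; split.
      by rewrite -(natrB _ (isT : (0 < n)%N)) subn1 -natrM ler_nat.
    by rewrite natr1 -natrM ler_nat.
  rewrite !natrD addrAC addrK in ms sm.
  have hN : h = 2 * N%:R by rewrite /h natrM.
  have sb : `|s - n%:R * h| <= N%:R.
    by rewrite ler_norml; apply/andP; split; nra.
  have n1 : 1 <= n%:R :> R by rewrite ler1n.
  have nh : h <= n%:R * h by rewrite ler_peMl// ltW.
  have /andP[sb1 sb2] : - N%:R <= s - n%:R * h <= N%:R by rewrite -ler_norml.
  have N0' : 0 < N%:R :> R by rewrite ltr0n.
  split.
  - rewrite normrM gtr0_norm//.
    have : a * `|s - n%:R * h| <= a * N%:R by rewrite ler_wpM2l// ltW.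
    move/le_trans; apply.
    have -> : a * N%:R = (pi / 2) / 2 by rewrite /a hN; field; rewrite gt_eqF.
    by have := @pihalf_lt2 R; lra.
  - by lra.
  - by lra.
(* The first [N] bands lie around the frequency 0, which is not sampled; they
   only add a constant. *)
exists (\sum_(1 <= m < N + 1) band m ^+ 2 + k ^+ 2 * ((2 * N)%:R * D)) => M.
have : \sum_(1 <= m < M) band m ^+ 2 <=
    \sum_(1 <= m < N + 1 + M * (2 * N)) band m ^+ 2.
  have [M0|M0] := leqP M 1.
    by rewrite (big_geq M0) sumr_ge0// => *; exact: sqr_ge0.
  rewrite [leRHS](@big_cat_nat _ _ _ M)//=; last first.
  - by rewrite (leq_trans _ (leq_addl _ _))// leq_pmulr.
  - exact: ltnW.
  by rewrite lerDl sumr_ge0// => *; exact: sqr_ge0.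
move/le_trans; apply.
rewrite (@big_cat_nat _ _ _ (N + 1))//= ?leq_addr ?addn1// lerD2l.
rewrite -addn1 -{1}[(N + 1)%N]add0n big_addn addKn.
apply: (@le_trans _ _ (\sum_(0 <= j < M * (2 * N)) k ^+ 2 * S (j %/ (2 * N)).+1 ^+ 2)).
  apply: ler_sum => j _; rewrite -exprMn addnC lerXn2r ?nnegrE//.
    by rewrite band_ge0// addn1.
  by rewrite (le_trans _ (bandS j))// band_ge0// addn1.
rewrite -big_distrr/= ler_wpM2l ?sqr_ge0//.
rewrite (sum_blocks (fun j => S j.+1 ^+ 2)) ?muln_gt0// ler_wpM2l//.
by have := hD M.+1; rewrite big_add1.
Qed.

End local_square_integrability.

(** * The local energy of a sine transform *)

Section sine_energy.
Context {R : realType}.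
Local Notation mu := (@lebesgue_measure R).
Local Notation Intg f := (mu.-integrable [set: R] (EFin \o f)).
Local Notation r := fejer_root.
Local Notation c := (@fejer_mass R).
Implicit Types a s t x y z : R.

Lemma measurable_sin_mul : measurable_fun [set: R * R] (fun w : R * R => sin (w.1 * w.2)).
Proof. by apply: (measurableT_comp measurable_sin); exact: measurable_funM. Qed.

Lemma measurable_cos_mul : measurable_fun [set: R * R] (fun w : R * R => cos (w.1 * w.2)).
Proof. by apply: (measurableT_comp measurable_cos); exact: measurable_funM. Qed.

Definition sine_transform (Q : R -> R) x := \int[mu]_s (Q s * sin (x * s)).

Variable Q : R -> R.
Hypothesis hQ : Intg Q.
Local Notation g := (sine_transform Q).

Lemma measurable_sine_transform : measurable_fun [set: R] g.
Proof.
apply: measurable_integral_kernel; first exact: Intg_measurable.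
exact: measurable_sin_mul.
Qed.

Lemma sine_transform_le x : `|g x| <= \int[mu]_s `|Q s|.
Proof.
apply: le_norm_integral; [|exact: Intg_abs|].
- apply: (@IntgM _ 1) => //; last by move=> s; exact: sin_max.
  exact: (measurableT_comp measurable_sin (measurable_mulr _)).
- by move=> s; rewrite normrM ler_piMr// sin_max.
Qed.

Lemma Intg_mul_sine_transform (f : R -> R) : Intg f -> Intg (fun x => f x * g x).
Proof.
move=> hf; apply: IntgM hf; first exact: measurable_sine_transform.
exact: sine_transform_le.
Qed.

Lemma integral_mul_sine_transform (f : R -> R) : Intg f ->
  \int[mu]_x (f x * g x) = \int[mu]_s (Q s * \int[mu]_x (f x * sin (x * s))).
Proof.
move=> hf; apply: (@integral_swap _ f Q (fun x s => sin (x * s)) 1) => //.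
  exact: measurable_sin_mul.
by move=> x s; exact: sin_max.
Qed.

(** Consecutive intervals overlap on a unit interval, so that two points of the
half-line at distance less than 1 lie in a common interval. *)
Definition overlap (j : nat) : set R := `[j%:R - 1, j%:R + 1[%classic.

Lemma in_overlap (j : nat) s : (s \in overlap j) = (j%:R - 1 <= s < j%:R + 1).
Proof. by apply/idP/idP; rewrite inE /overlap/= in_itv. Qed.

Definition overlap_mass (j : nat) := \int[mu]_s (`|Q s| * \1_(overlap j) s).
Local Notation h := overlap_mass.

Lemma Intg_overlap j : Intg (fun s => `|Q s| * \1_(overlap j) s).
Proof.
apply: (@IntgM _ 1); last exact: Intg_abs.
  by apply: measurable_indic; exact: measurable_itv.
by move=> s; rewrite indicE; case: (_ \in _); rewrite ?normr1 ?normr0.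
Qed.

Lemma overlap_mass_ge0 j : 0 <= h j.
Proof. by apply: Rintegral_ge0 => s _; rewrite mulr_ge0. Qed.

Hypothesis Q0 : forall s, s < 0 -> Q s = 0.

(** Exchanging the integrals gives the integral of [Q t] against a difference of two
triangles of width at most 1; for [s, t >= 0] both vanish when [s] and [t] are
at distance at least 1, so only the two intervals around [s] contribute. *)
Lemma sine_form_le a s : 0 < a -> 2 * a <= 1 -> 0 <= s ->
  `|\int[mu]_x (r a x ^+ 2 * g x * sin (x * s))| <=
  c * a / 2 * (h (Num.truncn s) + h (Num.truncn s).+1).
Proof.
move=> a0 a1 s0; set k := Num.truncn s.
have hws : Intg (fun x => r a x ^+ 2 * sin (x * s)).
  apply: (@IntgM _ 1); [|by move=> x; exact: sin_max|exact: Intg_fejer].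
  by apply: (measurableT_comp measurable_sin); exact: measurable_funM.
under eq_Rintegral do rewrite mulrAC.
rewrite integral_mul_sine_transform//.
have trib x : 0 <= triangle a x <= a by rewrite triangle_ge0 triangle_le// ltW.
have EQ t : Q t * (\int[mu]_x (r a x ^+ 2 * sin (x * s) * sin (x * t))) =
    Q t * (c / 2 * (triangle a (s - t) - triangle a (s + t))).
  congr (_ * _); rewrite -fejer_sin_sin; apply: eq_Rintegral => x _.
  by rewrite -mulrA ![x * _]mulrC.
under eq_Rintegral do rewrite EQ.
have c0 := @fejer_mass_gt0 R.
rewrite -(integralDR (Intg_overlap k) (Intg_overlap k.+1)).
have hD := IntgD (Intg_overlap k) (Intg_overlap k.+1).
rewrite -(integralZR _ hD); apply: le_norm_integral; [|exact: IntgZ|].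
- apply: (@IntgM _ (c / 2 * a)) => //.
    apply: measurable_funM => //; apply: measurable_funB.
      by apply: (measurableT_comp (measurable_triangle a)); exact: measurable_funB.
    by apply: (measurableT_comp (measurable_triangle a)); exact: measurable_funD.
  move=> t; have /andP[? ?] := trib (s - t); have /andP[? ?] := trib (s + t).
  rewrite normrM ger0_norm ?divr_ge0 ?(ltW c0)// ler_wpM2l ?divr_ge0 ?(ltW c0)//.
  by rewrite ler_norml; apply/andP; split; lra.
move=> t; have [t0|t0] := ltP t 0.
  rewrite Q0// mul0r normr0 mul0r mul0r addr0 mulr0//.
have /andP[ks sk] : k%:R <= s < k.+1%:R by exact: truncn_itv.
rewrite -natr1 in sk.
rewrite normrM -mulrDr mulrCA ler_wpM2l//.
have [far|near] := leP 1 `|s - t|.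
  rewrite !triangle_large ?(ltW a0)//.
  - by rewrite subr0 mulr0 normr0 mulr_ge0// divr_ge0// mulr_ge0// ltW.
  - rewrite (le_trans a1)// (le_trans far)//.
    by rewrite (le_trans (ler_normB _ _))// !ger0_norm// addr_ge0.
  - exact: le_trans far.
have : 1 <= \1_(overlap k) t + \1_(overlap k.+1) t :> R.
  move: near; rewrite ltr_norml => /andP[? ?].
  rewrite !indicE !in_overlap -natr1.
  have [tk|tk] := ltP t k%:R.
    rewrite (_ : k%:R - 1 <= t < k%:R + 1) ?lerDl//; by apply/andP; split; lra.
  rewrite (_ : k%:R + 1 - 1 <= t < k%:R + 1 + 1) ?lerDr//; by apply/andP; split; lra.
set I := _ + _ => I1.
have /andP[? ?] := trib (s - t); have /andP[? ?] := trib (s + t).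
have le1 : `|triangle a (s - t) - triangle a (s + t)| <= a by rewrite ler_norml; apply/andP; split; lra.
rewrite normrM ger0_norm ?divr_ge0 ?(ltW c0)//.
rewrite (_ : c * a / 2 * I = c / 2 * (a * I)); last by field.
rewrite ler_wpM2l ?divr_ge0 ?(ltW c0)// (le_trans le1)//.
by rewrite ler_peMr// ltW.
Qed.

(** The left-hand side is the integral of [Q s] against the form bounded by
[sine_form_le].  Bounding [`|Q s|] times the two masses around [s] by the sum
over all intervals containing [s] and integrating gives the sum of the squares of
the masses. *)
Lemma sine_energy a (E : R) : 0 < a -> 2 * a <= 1 ->
  (forall M : nat, \sum_(0 <= j < M) h j ^+ 2 <= E) ->
  \int[mu]_x (r a x ^+ 2 * g x ^+ 2) <= c * a / 2 * E.
Proof.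
move=> a0 a1 hE.
have hwg : Intg (fun x => r a x ^+ 2 * g x) by exact/Intg_mul_sine_transform/Intg_fejer.
pose Psi s := \int[mu]_x (r a x ^+ 2 * g x * sin (x * s)).
have -> : \int[mu]_x (r a x ^+ 2 * g x ^+ 2) = \int[mu]_s (Q s * Psi s).
  rewrite -integral_mul_sine_transform//.
  by apply: eq_Rintegral => x _; rewrite expr2 mulrA.
have mPsi : measurable_fun [set: R] Psi.
  rewrite (_ : Psi = fun s => \int[mu]_x (r a x ^+ 2 * g x * sin (s * x))).
    apply: measurable_integral_kernel; first exact: Intg_measurable.
    exact: measurable_sin_mul.
  by apply/funext => s; apply: eq_Rintegral => x _; rewrite [x * s]mulrC.
have c0 := @fejer_mass_gt0 R.
have ca0 : 0 <= c * a / 2 by rewrite divr_ge0// mulr_ge0// ltW.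
have hQPsi : Intg (fun s => Q s * Psi s).
  apply: (@IntgM _ (\int[mu]_x `|r a x ^+ 2 * g x|)) => // s.
  apply: le_norm_integral; [|exact: Intg_abs|].
    apply: (@IntgM _ 1) => //; last by move=> x; exact: sin_max.
    by apply: (measurableT_comp measurable_sin); exact: measurable_funM.
  by move=> x; rewrite normrM ler_piMr// sin_max.
apply: (@le_trans _ _ (\int[mu]_s `|Q s * Psi s|)).
  by rewrite (le_trans (ler_norm _))// le_normr_Rintegral.
rewrite -lee_fin -EFin_integral; last exact: Intg_abs.
pose f j s := (c * a / 2 * (h j * (`|Q s| * \1_(overlap j) s)))%:E.
have f0 j s : (0 <= f j s)%E.
  by rewrite lee_fin (mulr_ge0 ca0)// mulr_ge0 ?overlap_mass_ge0// mulr_ge0.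
have mf j : measurable_fun [set: R] (f j).
  apply/measurable_EFinP; apply: measurable_funM => //; apply: measurable_funM => //.
  exact: Intg_measurable (Intg_overlap j).
apply: (@le_trans _ _ (\int[mu]_s (\sum_(j <oo) f j s))%E).
  apply: ge0_le_integral => //.
  - by apply/measurable_EFinP; exact: Intg_measurable (Intg_abs hQPsi).
  - exact: (@ge0_emeasurable_sum _ _ _ _ f xpredT).
  move=> s _; have [s0|s0] := ltP s 0.
    by rewrite Q0// mul0r normr0; exact: nneseries_ge0.
  set k := Num.truncn s.
  apply: le_trans (nneseries_lim_ge k.+2 _) => //.
  rewrite big_nat_recr//= big_nat_recr//= -addeA.
  apply: (@le_trans _ _ (f k s + f k.+1 s)%E); last first.
    by apply: leeDr; exact: sume_ge0.
  have /andP[ks sk] : k%:R <= s < k.+1%:R by exact: truncn_itv.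
  rewrite -natr1 in sk.
  have o1 : \1_(overlap k) s = 1 :> R.
    by rewrite indicE in_overlap; case: andP => // -[]; split; lra.
  have o2 : \1_(overlap k.+1) s = 1 :> R.
    by rewrite indicE in_overlap -[k.+1%:R]natr1; case: andP => // -[]; split; lra.
  rewrite /f o1 o2 -EFinD lee_fin normrM !mulr1.
  have le1 := sine_form_le a0 a1 s0.
  apply: (le_trans (ler_wpM2l (normr_ge0 (Q s)) le1)).
  by rewrite le_eqVlt; apply/orP; left; apply/eqP; ring.
rewrite integral_nneseries//.
have If j : (\int[mu]_s f j s = (c * a / 2 * h j ^+ 2)%:E)%E.
  rewrite EFin_integral; last exact/IntgZ/IntgZ/Intg_overlap.
  rewrite integralZR; last exact/IntgZ/Intg_overlap.
  by rewrite integralZR//; exact: Intg_overlap.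
under eq_eseriesr do rewrite If.
apply: lime_le.
  by apply: is_cvg_nneseries => j _ _; rewrite lee_fin mulr_ge0// sqr_ge0.
apply: nearW => M; rewrite sumEFin lee_fin -big_distrr/=.
by rewrite ler_wpM2l.
Qed.

End sine_energy.

(** * The smoothing kernel *)

Section smoothing_kernel.
Context {R : realType}.
Local Notation mu := (@lebesgue_measure R).
Local Notation Intg f := (mu.-integrable [set: R] (EFin \o f)).
Local Notation r := fejer_root.
Local Notation c := (@fejer_mass R).
Implicit Types a s t u v w x y z : R.

Lemma Intg_itv u v : Intg (\1_(`[u, v]%classic : set R)).
Proof. exact: integrable_indic_itv. Qed.

Lemma in_itvcc u v w : (w \in (`[u, v]%classic : set R)) = (u <= w <= v).
Proof. by apply/idP/idP; rewrite inE/= in_itv. Qed.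

Lemma integral_itv_indic u v : u <= v ->
  \int[mu]_w (\1_(`[u, v]%classic : set R) w) = v - u.
Proof.
move=> uv; have h : lebesgue_measure (`[u, v]%classic : set R) = (v - u)%:E.
  rewrite lebesgue_measure_itv/= lte_fin; case: ltP => // vu.
  by rewrite (le_anti (introT andP (conj uv vu))) subrr.
have mI : measurable (`[u, v]%classic : set R) by exact: measurable_itv.
by rewrite /Rintegral integral_indic// setIT; exact: (congr1 fine h).
Qed.

Lemma integral_itv_cos u v s : u < v ->
  s * \int[mu]_w (\1_(`[u, v]%classic : set R) w * cos (s * w)) =
  sin (s * v) - sin (s * u).
Proof.
move=> uv; have [->|s0] := eqVneq s 0; first by rewrite !mul0r sin0 subrr.
pose F w := s^-1 * sin (s * w).
have dF w : is_derive w 1 F (cos (s * w)).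
  have h1 : is_derive w 1 (fun y : R => s * y) s.
    by apply: is_derive_eq; rewrite /GRing.scale/= mulr1.
  have h2 : is_derive w 1 (@sin R \o (fun y : R => s * y)) (cos (s * w) * s).
    exact: is_derive1_comp.
  have h3 := @is_deriveZ _ _ _ _ s^-1 _ _ _ h2.
  apply: is_derive_eq h3 _; rewrite /GRing.scale/= mulrCA mulVf ?mulr1//.
have cF : continuous F.
  by move=> w; apply: differentiable_continuous; apply/derivable1_diffP; exact: (@ex_derive _ _ _ _ _ _ _ (dF w)).
have H : (\int[mu]_(w in `[u, v]) (cos (s * w))%:E = (F v)%:E - (F u)%:E)%E.
  apply: continuous_FTC2 => //.
  - apply: continuous_subspaceT => w.
    apply: (@continuous_comp _ _ _ (fun w => s * w) (@cos R)); last exact: continuous_cos.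
    exact: mulrl_continuous.
  - split.
    + by move=> w _; exact: (@ex_derive _ _ _ _ _ _ _ (dF w)).
    + by apply: cvg_at_right_filter; exact: cF.
    + by apply: cvg_at_left_filter; exact: cF.
  - by move=> w _; rewrite derive1E; exact: (@derive_val _ _ _ _ _ _ _ (dF w)).
have -> : \int[mu]_w (\1_(`[u, v]%classic : set R) w * cos (s * w)) = F v - F u.
  rewrite /Rintegral -[RHS]/(fine ((F v)%:E - (F u)%:E)) -H.
  rewrite [in RHS]integral_mkcond; congr fine; apply: eq_integral => w _.
  rewrite /= patchE indicE; case: ifP => _; by rewrite ?mul1r ?mul0r.
by rewrite /F mulrBr !mulrA divff// !mul1r.
Qed.

(** The Fejer root is the cosine transform of an interval. *)
Lemma integral_box_cos e z s : 0 < e ->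
  \int[mu]_w (\1_(`[z - e, z + e]%classic : set R) w * cos (s * w)) =
  2 * (r e s * cos (z * s)).
Proof.
move=> e0; have [->|s0] := eqVneq s 0.
  under eq_Rintegral do rewrite mul0r cos0 mulr1.
  rewrite integral_itv_indic; last by lra.
  by rewrite /r phiC phi0 mulr0 cos0; ring.
apply: (mulfI s0); rewrite integral_itv_cos; last by lra.
rewrite [RHS](_ : _ = 2 * (s * r e s) * cos (z * s)); last by ring.
rewrite mul_fejer_root.
by rewrite ![s * (_ + _)]mulrDr mulrN sinD sinB [z * s]mulrC [e * s]mulrC; ring.
Qed.

(** The exponent 3 makes the frequencies decay fast enough for the exchange of
integrals in [smoothedE], which needs one more power of [s] than the Fejer
kernel itself allows. *)
Definition smoothing e z := \int[mu]_s (r e s ^+ 3 * cos (z * s)).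

Lemma Intg_fejer3 e : Intg (fun s => r e s ^+ 3).
Proof.
under eq_fun do rewrite exprSr.
apply: (@IntgM _ `|e|); [exact: measurable_fejer_root|exact: fejer_root_le|].
exact: Intg_fejer.
Qed.

Lemma Intg_itv_triangle e u v : 0 <= e ->
  Intg (fun w => \1_(`[u, v]%classic : set R) w * triangle e w).
Proof.
move=> e0; apply: (@IntgM _ e); [exact: measurable_triangle| |exact: Intg_itv].
by move=> w; rewrite ger0_norm ?triangle_ge0 ?triangle_le.
Qed.

(** One factor of the cube is the cosine transform of an interval and the other two
form a Fejer kernel, so that the smoothing kernel is a moving average of
triangles.  Its sign, size and support follow. *)
Lemma smoothingE e z : 0 < e -> smoothing e z =
  c / 2 * \int[mu]_w (\1_(`[z - e, z + e]%classic : set R) w * triangle e w).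
Proof.
move=> e0; transitivity (2^-1 * \int[mu]_s (r e s ^+ 2 *
    \int[mu]_w (\1_(`[z - e, z + e]%classic : set R) w * cos (s * w)))).
  rewrite -integralZR.
    by apply: eq_Rintegral => s _; rewrite integral_box_cos//; field.
  under eq_fun do rewrite integral_box_cos// mulrCA.
  apply: IntgZ; under eq_fun do rewrite mulrA.
  apply: (@IntgM _ 1); [|by move=> s; exact: cos_max|].
    exact: (measurableT_comp measurable_cos (measurable_mulr _)).
  by under eq_fun do rewrite -exprSr; exact: Intg_fejer3.
rewrite (@integral_swap _ _ _ (fun s w => cos (s * w)) 1).
- have h := integralZR c (Intg_itv_triangle (z - e) (z + e) (ltW e0)).
  rewrite [RHS](_ : _ = 2^-1 * (c * \int[mu]_w (\1_(`[z - e, z + e]%classic : set R) w *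
    triangle e w))); last by ring.
  rewrite -h; congr (_ * _); apply: eq_Rintegral => w _.
  rewrite mulrCA -fejer_cos; congr (_ * _); apply: eq_Rintegral => s _.
  by rewrite [s * w]mulrC.
- exact: Intg_fejer.
- exact: Intg_itv.
- exact: measurable_cos_mul.
- by move=> *; exact: cos_max.
Qed.

Lemma smoothing_ge0 e z : 0 < e -> 0 <= smoothing e z.
Proof.
move=> e0; rewrite smoothingE// mulr_ge0//.
  by rewrite divr_ge0// ltW// fejer_mass_gt0.
by apply: Rintegral_ge0 => w _; rewrite mulr_ge0// triangle_ge0.
Qed.

Lemma smoothing_le e z : 0 < e -> smoothing e z <= c * e ^+ 2.
Proof.
move=> e0; rewrite smoothingE//; have c0 := @fejer_mass_gt0 R.
rewrite (_ : c * e ^+ 2 = c / 2 * (e * (z + e - (z - e)))); last by field.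
rewrite ler_wpM2l ?divr_ge0 ?(ltW c0)//.
rewrite -integral_itv_indic; last by lra.
rewrite -integralZR; last exact: Intg_itv.
apply: le_integralR; [exact: Intg_itv_triangle (ltW e0)|exact/IntgZ/Intg_itv|].
by move=> w; rewrite mulrC ler_wpM2r// triangle_le// ltW.
Qed.

Lemma smoothing_far e z : 0 < e -> 3 * e <= `|z| -> smoothing e z = 0.
Proof.
move=> e0 ez; rewrite smoothingE// (_ : Rintegral _ _ _ = 0) ?mulr0//.
rewrite -[RHS](_ : \int[mu]_w (0 : R) = 0); last by rewrite Rintegral_cst// mul0r.
apply: eq_Rintegral => w _; rewrite indicE in_itvcc.
case: (boolP (_ <= w <= _)) => [/andP[h1 h2]|_]; last by rewrite mul0r.
rewrite triangle_large ?mulr0 ?(ltW e0)//.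
have : `|z - w| <= e by rewrite ler_norml; apply/andP; split; lra.
by have := ler_normD (z - w) w; rewrite subrK; lra.
Qed.

Lemma smoothing_near e z : 0 < e -> `|z| <= e -> c * e ^+ 2 / 4 <= smoothing e z.
Proof.
move=> e0; rewrite ler_norml => /andP[z1 z2]; rewrite smoothingE//.
have c0 := @fejer_mass_gt0 R.
(* One of the halves of [-e, e] lies inside the averaging window, and the triangle
   is at least [e / 2] there. *)
have [u [v [vu uz zv we]]] : exists u v, [/\ v - u = e, z - e <= u, v <= z + e &
    forall w, u <= w <= v -> `|w| <= e].
  have [z0|z0] := leP 0 z.
    exists 0, e; split; [by lra..|] => w /andP[? ?].
    by rewrite ler_norml; apply/andP; split; lra.
  exists (- e), 0; split; [by lra..|] => w /andP[? ?].
  by rewrite ler_norml; apply/andP; split; lra.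
have -> : c * e ^+ 2 / 4 = c / 2 * (e / 2 * (v - u)) by rewrite vu; field.
rewrite ler_wpM2l ?divr_ge0 ?(ltW c0)//.
rewrite -integral_itv_indic; last by lra.
rewrite -integralZR; last exact: Intg_itv.
apply: le_integralR; [exact/IntgZ/Intg_itv|exact: Intg_itv_triangle (ltW e0)|].
move=> w; rewrite !indicE !in_itvcc; case: (boolP (u <= w <= v)) => [uwv|_]; last first.
  by rewrite mulr0 mulr_ge0// triangle_ge0.
have wle := we _ uwv; case/andP: uwv => uw wv.
have -> : z - e <= w <= z + e by apply/andP; split; lra.
by rewrite mulr1 mul1r triangle_small; lra.
Qed.

Lemma measurable_smoothing e : measurable_fun [set: R] (smoothing e).
Proof.
apply: measurable_integral_kernel; first exact: Intg_measurable (Intg_fejer3 e).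
exact: measurable_cos_mul.
Qed.

Lemma Intg_smoothing e : 0 < e -> Intg (smoothing e).
Proof.
move=> e0; apply: (@Intg_le _ _ (fun z => c * e ^+ 2 * \1_(`[- (3 * e), 3 * e]%classic : set R) z)).
- exact: measurable_smoothing.
- move=> z; rewrite ger0_norm ?smoothing_ge0// indicE in_itvcc -ler_norml.
  case: (boolP (`|z| <= 3 * e)) => ze; first by rewrite mulr1 smoothing_le.
  by rewrite mulr0 smoothing_far// ltW// ltNge.
- exact/IntgZ/Intg_itv.
Qed.

Lemma smoothing_mass e : 0 < e -> c * e ^+ 3 / 2 <= \int[mu]_z smoothing e z.
Proof.
move=> e0; have -> : c * e ^+ 3 / 2 = c * e ^+ 2 / 4 * (e - - e) by field.
rewrite -integral_itv_indic; last by lra.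
rewrite -integralZR; last exact: Intg_itv.
apply: le_integralR; [exact/IntgZ/Intg_itv|exact: Intg_smoothing|move=> z].
rewrite indicE in_itvcc -ler_norml; case: (boolP (`|z| <= e)) => ze.
  by rewrite mulr1 smoothing_near.
by rewrite mulr0 smoothing_ge0.
Qed.

Lemma measurable_sg : measurable_fun [set: R] (@Num.sg R).
Proof.
have -> : @Num.sg R = fun s => \1_(`]0, +oo[%classic : set R) s -
    \1_(`]-oo, 0[%classic : set R) s.
  apply/funext => s; rewrite !indicE !mem_setE/= !in_itv/= andbT.
  by case: sgrP; rewrite ?subr0 ?sub0r.
by apply: measurable_funB; apply: measurable_indic; exact: measurable_itv.
Qed.

(** The value 1/2 at the origin makes the sum of this function and of its reflection
equal to 1 everywhere. *)
Definition heaviside s : R := (1 + Num.sg s) / 2.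

Lemma measurable_heaviside : measurable_fun [set: R] heaviside.
Proof. by apply: measurable_funM => //; apply: measurable_funD => //; exact: measurable_sg. Qed.

Lemma norm_heaviside_le s : `|heaviside s| <= 1.
Proof. by rewrite /heaviside; case: sgrP => _; rewrite ger0_norm; lra. Qed.

Lemma heaviside_neg s : s < 0 -> heaviside s = 0.
Proof. by move=> s0; rewrite /heaviside ltr0_sg// subrr mul0r. Qed.

(** The difference of both sides is half the integral of the odd function [Num.sg s * f s]. *)
Lemma integral_heaviside (f : R -> R) : Intg f -> (forall s, f (- s) = f s) ->
  \int[mu]_s (heaviside s * f s) = 2^-1 * \int[mu]_s f s.
Proof.
move=> hf fN; have hsf : Intg (fun s => f s * Num.sg s).
  apply: (@IntgM _ 1) => //; first exact: measurable_sg.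
  by move=> s; case: sgrP; rewrite ?normrN ?normr0 ?normr1.
rewrite (_ : (fun _ => _) = fun s => 2^-1 * (f s + f s * Num.sg s)); last first.
  by apply/funext => s; rewrite /heaviside; ring.
rewrite integralZR ?integralDR//; last exact: IntgD.
rewrite (integral_odd _ _ hsf) ?addr0//; first exact: Intg_measurable.
by move=> s; rewrite sgrN fN mulrN.
Qed.

End smoothing_kernel.

(** * Smoothing by damping the frequencies *)

Section band_control.
Context {R : realType}.
Local Notation mu := (@lebesgue_measure R).
Local Notation Intg f := (mu.-integrable [set: R] (EFin \o f)).
Local Notation r := fejer_root.
Local Notation c := (@fejer_mass R).
Implicit Types a e s t u v w x y z : R.

Variable p : R -> R.
Hypothesis hp : Intg p.
Hypothesis p0 : forall x, x <= 0 -> p x = 0.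
Hypothesis hat_ge0 : forall s, 0 <= s -> 0 <= transform p s.

(** On the positive frequencies this is [s * r e s ^+ 3], with [r] the Fejer root;
the factor [s] turns the transform into a sine transform. *)
Definition damping e s := heaviside s * (sin (e * s) * r e s ^+ 2).

Lemma Intg_damping e : Intg (damping e).
Proof.
rewrite (_ : damping e = fun s => r e s ^+ 2 * sin (e * s) * heaviside s); last first.
  by apply/funext => s; rewrite /damping; ring.
apply: (@IntgM _ 1); [exact: measurable_heaviside|exact: norm_heaviside_le|].
apply: (@IntgM _ 1); [|by move=> s; exact: sin_max|exact: Intg_fejer].
exact: (measurableT_comp measurable_sin (measurable_mulr _)).
Qed.

Definition damped e s := damping e s * transform p s.

Lemma Intg_damped e : Intg (damped e).
Proof. exact/Intg_mul_transform/Intg_damping. Qed.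

Lemma damped_neg e s : s < 0 -> damped e s = 0.
Proof. by move=> s0; rewrite /damped /damping heaviside_neg// !mul0r. Qed.

(** As [sin (e * s) = s * r e s], damping multiplies the nonnegative function
[s * transform p s] by at most [r e s ^+ 3], and [`|r e s| <= e]. *)
Lemma damped_le e s : 0 < e -> 0 <= s ->
  `|damped e s| <= e ^+ 3 * (s * transform p s).
Proof.
move=> e0 s0; rewrite /damped normrM (ger0_norm (hat_ge0 s0)).
rewrite mulrA ler_wpM2r ?hat_ge0// /damping normrM.
apply: (@le_trans _ _ (1 * `|sin (e * s) * r e s ^+ 2|)).
  by rewrite ler_wpM2r// norm_heaviside_le.
rewrite mul1r -mul_fejer_root -mulrA -exprS normrM ger0_norm// mulrC ler_wpM2r//.
have := fejer_root_le e s; rewrite (gtr0_norm e0) => le1.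
by rewrite normrX lerXn2r ?nnegrE// ltW.
Qed.

Definition smoothed e x := sine_transform (damped e) x.

(** After the exchange of integrals, the product of the two sines gives the smoothing
kernel at [x - y] and at [x + y]; the second one vanishes since [y >= 0] and [x]
is at least the radius [3 * e] of its support. *)
Lemma smoothedE e x : 0 < e -> 3 * e <= x ->
  4 * smoothed e x = \int[mu]_y (p y / y * smoothing e (x - y)).
Proof.
move=> e0 ex.
have hq : Intg (fun s => damping e s * sin (x * s)).
  apply: (@IntgM _ 1); [|by move=> s; exact: sin_max|exact: Intg_damping].
  exact: (measurableT_comp measurable_sin (measurable_mulr _)).
have -> : smoothed e x = \int[mu]_s (damping e s * sin (x * s) * transform p s).
  by apply: eq_Rintegral => s _; rewrite /damped mulrAC.
rewrite integral_mul_transform//.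
rewrite -integralZR; last first.
  apply: (@IntgM _ (\int[mu]_s `|damping e s * sin (x * s)|)) => //.
    under eq_fun do under eq_Rintegral do rewrite phiC.
    exact: measurable_transform (Intg_measurable hq).
  move=> y; under eq_Rintegral do rewrite phiC.
  exact: transform_le.
apply: eq_Rintegral => y _; have [y0|y0] := leP y 0.
  by rewrite p0// !(mul0r, mulr0).
have hcos z : Intg (fun s => r e s ^+ 3 * cos (z * s)).
  apply: (@IntgM _ 1); [|by move=> s; exact: cos_max|exact: Intg_fejer3].
  exact: (measurableT_comp measurable_cos (measurable_mulr _)).
have E1 : \int[mu]_s (damping e s * sin (x * s) * phi s y) =
    y^-1 * \int[mu]_s (heaviside s * (r e s ^+ 3 * (sin (x * s) * sin (y * s)))).
  have hss : Intg (fun s => r e s ^+ 3 * (sin (x * s) * sin (y * s))).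
    apply: (@IntgM _ 1); last exact: Intg_fejer3.
      apply: measurable_funM;
        exact: (measurableT_comp measurable_sin (measurable_mulr _)).
    by move=> s; rewrite normrM mulr_ile1// sin_max.
  rewrite -integralZR; last first.
    under eq_fun do rewrite mulrC.
    by apply: (@IntgM _ 1) => //; [exact: measurable_heaviside|exact: norm_heaviside_le].
  apply: eq_Rintegral => s _; apply: (mulfI (lt0r_neq0 y0)).
  rewrite [RHS]mulrA divff ?lt0r_neq0// mul1r [y * s]mulrC -(mul_phi s y).
  by rewrite /damping -(mul_fejer_root e s); ring.
have E2 : \int[mu]_s (r e s ^+ 3 * (sin (x * s) * sin (y * s))) =
    2^-1 * (smoothing e (x - y) - smoothing e (x + y)).
  rewrite -integralBR ?hcos// -integralZR; last exact: IntgB.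
  apply: eq_Rintegral => s _; rewrite mulrBl mulrDl cosB cosD; by field.
rewrite E1 integral_heaviside; last 2 first.
- apply: (@IntgM _ 1); last exact: Intg_fejer3.
    apply: measurable_funM;
      exact: (measurableT_comp measurable_sin (measurable_mulr _)).
  by move=> s; rewrite normrM mulr_ile1// sin_max.
- by move=> s; rewrite fejer_rootN !mulrN !sinN mulrNN.
rewrite E2 [smoothing e (x + y)]smoothing_far//; first by field; rewrite gt_eqF.
by rewrite ger0_norm; lra.
Qed.

(** * Convergence at Lebesgue points *)

(** Near 0 the function [p y / y] need not be integrable; Lebesgue's theorem is
applied away from 0. *)
Definition truncated (rho y : R) := p y / y * \1_(`[rho, +oo[%classic : set R) y.

Lemma in_itvcy (rho y : R) : (y \in (`[rho, +oo[%classic : set R)) = (rho <= y).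
Proof. by apply/idP/idP; rewrite inE/= in_itv/= andbT. Qed.

Lemma measurable_pdiv : measurable_fun [set: R] (fun x => p x / x).
Proof. exact: measurable_funM (Intg_measurable hp) measurable_inv. Qed.

Lemma Intg_truncated (rho : R) : 0 < rho -> Intg (truncated rho).
Proof.
move=> rho0; apply: (@Intg_le _ _ (fun y => rho^-1 * `|p y|)).
- apply: measurable_funM; first exact: measurable_pdiv.
  by apply: measurable_indic; exact: measurable_itv.
- move=> y; rewrite /truncated indicE in_itvcy; case: (boolP (rho <= y)) => ry; last first.
    by rewrite mulr0 normr0 mulr_ge0// invr_ge0 ltW.
  have y0 : 0 < y by exact: lt_le_trans ry.
  by rewrite mulr1 normrM mulrC ler_wpM2r// normfV gtr0_norm// lef_pV2.
- exact/IntgZ/Intg_abs.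
Qed.

Definition deviation (rho x d y : R) :=
  `|truncated rho y - truncated rho x| * \1_(ball x d) y.

Lemma Intg_deviation (rho x d : R) : 0 < rho -> Intg (deviation rho x d).
Proof.
move=> rho0; have htr := Intg_truncated rho0.
have mB : measurable (ball x d) by exact: measurable_ball.
apply: (@Intg_le _ _ (fun y => `|truncated rho y| +
    `|truncated rho x| * \1_(ball x d) y)).
- apply: measurable_funM; last exact: measurable_indic.
  apply: (measurableT_comp (@normr_measurable _ setT)).
  by apply: measurable_funB => //; exact: Intg_measurable htr.
- move=> y; rewrite normrM !normr_id indicE; case: (_ \in _).
    by rewrite normr1 !mulr1 ler_normB.
  by rewrite normr0 !mulr0 addr0.
- apply: IntgD; first exact: Intg_abs.
  by apply: IntgZ; rewrite ball_itv; exact: integrable_indic_itv.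
Qed.

Lemma davg_truncated (rho x d : R) : 0 < rho -> 0 < d ->
  davg (truncated rho) x d = ((2 * d)^-1 * \int[mu]_y deviation rho x d y)%:E.
Proof.
move=> rho0 d0; have hd := Intg_deviation x d rho0.
rewrite /davg /iavg lebesgue_measure_ball ?(ltW d0)// -(mulr_natl d 2).
rewrite inver mulf_eq0 pnatr_eq0 (gt_eqF d0)/= EFinM -EFin_integral//.
congr (_ * _)%E; rewrite integral_mkcond; apply: eq_integral => y _.
rewrite patchE /deviation indicE; case: ifP => _; last by rewrite mulr0.
by rewrite mulr1.
Qed.

(** The smoothing kernel is at most [c * e ^+ 2] and is supported in the ball of
radius [3 * e], so the error is an average deviation. *)
Lemma smoothed_near (rho e x : R) : 0 < rho -> 0 < e -> rho <= x - 3 * e ->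
  `|4 * smoothed e x - (\int[mu]_z smoothing e z) * (p x / x)| <=
  c * e ^+ 2 * \int[mu]_y deviation rho x (3 * e) y.
Proof.
move=> rho0 e0 rx; rewrite smoothedE//; last by lra.
pose k y := smoothing e (x - y).
have mk : measurable_fun [set: R] k.
  by apply: (measurableT_comp (measurable_smoothing e)); exact: measurable_funB.
have kle y : `|k y| <= c * e ^+ 2 by rewrite ger0_norm ?smoothing_ge0// smoothing_le.
have xE : p x / x = truncated rho x by rewrite /truncated indicE in_itvcy (_ : rho <= x) ?mulr1//; lra.
have kI : \int[mu]_y k y = \int[mu]_z smoothing e z.
  rewrite -(integral_opp mk) -(integral_shift x (measurable_smoothing e)).
  by apply: eq_Rintegral => y _; rewrite /k opprK addrC.
have hk : Intg k.
  have -> : k = fun y => smoothing e (- y + x) by apply/funext => y; rewrite /k addrC.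
  exact: (Intg_opp (Intg_shift x (Intg_smoothing e0))).
have htr := Intg_truncated rho0.
have htk : Intg (fun y => truncated rho y * k y) by exact: IntgM mk kle htr.
have -> : \int[mu]_y (p y / y * smoothing e (x - y)) = \int[mu]_y (truncated rho y * k y).
  apply: eq_Rintegral => y _; rewrite /truncated indicE in_itvcy.
  case: (boolP (rho <= y)) => ry; first by rewrite mulr1.
  rewrite mulr0 mul0r smoothing_far ?mulr0//.
  by move: ry; rewrite -ltNge => ry; rewrite ger0_norm; lra.
rewrite xE -kI [(\int[mu]_y k y) * _]mulrC -(integralZR _ hk) -(integralBR htk (IntgZ _ hk)).
have habs := Intg_deviation x (3 * e) rho0.
rewrite -(integralZR _ habs); apply: le_norm_integral; [|exact: IntgZ|].
  by apply: IntgB => //; exact: IntgZ.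
move=> y; rewrite -mulrBl normrM /deviation indicE.
case: (boolP (y \in _)) => yB; first by rewrite mulr1 mulrC ler_wpM2r.
rewrite !mulr0 /k smoothing_far ?normr0 ?mulr0//.
by rewrite leNgt; apply: contra yB => ?; rewrite inE -ball_normE.
Qed.

(** The mass of the smoothing kernel is at least [c * e ^+ 3 / 2], so the normalised
error is at most 12 times the mean deviation over the ball of radius [3 * e]. *)
Lemma smoothed_cvg (rho x : R) : 0 < rho -> rho < x -> lebesgue_pt (truncated rho) x ->
  4 * smoothed (n.+1%:R^-1) x / \int[mu]_z smoothing (n.+1%:R^-1) z @[n --> \oo] --> p x / x.
Proof.
move=> rho0 rx Lx.
pose e (n : nat) : R := n.+1%:R^-1.
have e0 n : 0 < e n by rewrite invr_gt0.
have ecvg : 3 * e n @[n --> \oo] --> (0 : R).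
  by rewrite -(mulr0 3); apply: cvgM; [exact: cvg_cst|exact: cvg_harmonic].
have c0 := @fejer_mass_gt0 R.
have D0 : davg (truncated rho) x (3 * e n) @[n --> \oo] --> 0%E.
  by apply: (cvge_at_rightP _ _ _).1 Lx _ _; split => // n; exact: mulr_gt0.
pose m n := \int[mu]_z smoothing (e n) z.
have mge n : c * e n ^+ 3 / 2 <= m n by exact: smoothing_mass.
have m0 n : 0 < m n by rewrite (lt_le_trans _ (mge n))// divr_gt0// mulr_gt0// exprn_gt0.
have D0' : 12 * fine (davg (truncated rho) x (3 * e n)) @[n --> \oo] --> (0 : R).
  by rewrite -(mulr0 12); apply: cvgM; [exact: cvg_cst|exact: (fine_cvg D0)].
apply/cvgrPdist_le => d d0; near=> n.
have rn : rho <= x - 3 * e n.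
  rewrite lerBrDl -lerBrDr; near: n.
  by apply: (cvgr_le _ ecvg); rewrite subr_gt0.
have := smoothed_near rho0 (e0 n) rn.
rewrite -/(m n) -/(e n); set I := \int[mu]_y _ => le1.
apply: (@le_trans _ _ (12 * fine (davg (truncated rho) x (3 * e n)))); last first.
  by near: n; exact: (cvgr_le _ D0').
rewrite davg_truncated ?mulr_gt0//= -/I.
have I0 : 0 <= I by apply: Rintegral_ge0 => y _; rewrite mulr_ge0.
have -> : p x / x - 4 * smoothed (e n) x / m n =
    - ((4 * smoothed (e n) x - m n * (p x / x)) / m n).
  by move: (p x / x) => q; field; rewrite gt_eqF.
rewrite normrN normrM normfV (gtr0_norm (m0 n)) ler_pdivrMr//.
apply: (le_trans le1).
have -> : c * e n ^+ 2 * I = 12 * ((2 * (3 * e n))^-1 * I) * (c * e n ^+ 3 / 2).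
  by field; rewrite gt_eqF.
by rewrite ler_wpM2l// mulr_ge0// mulr_ge0// invr_ge0 mulr_ge0// mulr_ge0// ltW.
Unshelve. all: by end_near. Qed.

Lemma smoothed_cvg_ae : {ae mu, forall x, 0 < x ->
  4 * smoothed (n.+1%:R^-1) x / \int[mu]_z smoothing (n.+1%:R^-1) z @[n --> \oo] --> p x / x}.
Proof.
have hL : {ae mu, forall x, forall i : nat, lebesgue_pt (truncated (i.+1%:R^-1)) x}.
  apply: ae_foralln => i; apply: lebesgue_differentiation.
  by apply: open_integrable_locally; [exact: openT|apply: Intg_truncated; rewrite invr_gt0].
apply: negligibleS hL => x; apply: contra_not => hx x0.
have [i xi] : exists i : nat, i.+1%:R^-1 < x.
  exists (Num.truncn x^-1); rewrite -[ltRHS]invrK ltf_pV2 ?posrE ?invr_gt0//.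
  by rewrite truncnS_gt.
by apply: (smoothed_cvg _ xi (hx i)); rewrite invr_gt0.
Qed.

End band_control.

(** * The bands control the square mass *)

Section square_mass.
Context {R : realType}.
Local Notation mu := (@lebesgue_measure R).
Local Notation Intg f := (mu.-integrable [set: R] (EFin \o f)).
Local Notation r := fejer_root.
Local Notation c := (@fejer_mass R).
Implicit Types a e s t u v w x y z : R.

Variable p : R -> R.
Hypothesis hp : Intg p.
Hypothesis p0 : forall x, x <= 0 -> p x = 0.
Hypothesis hat_ge0 : forall s, 0 <= s -> 0 <= transform p s.
Variable B : R.
Hypothesis bandB : forall M : nat, \sum_(1 <= m < M) band_mass p m ^+ 2 <= B.

Let B0 : 0 <= B.
Proof. by have := bandB 0; rewrite big_geq. Qed.

(* The band of index 0 is an interval of negative frequencies, which [damped]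
   does not see. *)
Let b (j : nat) : R := if j == 0%N then 0 else band_mass p j.

Let f (j : nat) s : R :=
  if j == 0%N then 0 else ((fun s => s * transform p s) \_ (unit_itv R j)) s.

Let Intg_f j : Intg (f j).
Proof.
rewrite /f; case: j => [|j]/=; first exact: integrable0.
exact: Intg_band.
Qed.

Let fE j : \int[mu]_s f j s = b j.
Proof.
rewrite /f /b; case: j => [|j]/=; first by rewrite Rintegral_cst// mul0r.
by rewrite /band_mass [RHS]Rintegral_mkcond.
Qed.

Let b_ge0 j : 0 <= b j.
Proof. by rewrite /b; case: eqP => // /eqP; rewrite -lt0n; exact: band_ge0. Qed.

Let f_ge0 j s : 0 <= f j s.
Proof.
rewrite /f; case: eqP => // /eqP; rewrite -lt0n => j0.
rewrite patchE in_unit_itv; case: ifP => // /andP[js _].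
have s0 : 0 <= s by rewrite (le_trans _ js)// subr_ge0 ler1n.
by rewrite mulr_ge0// hat_ge0.
Qed.

Let overlap_mass_damped e j : 0 < e ->
  overlap_mass (damped p e) j <= e ^+ 3 * (b j + b j.+1).
Proof.
move=> e0; rewrite -!fE -integralDR// -integralZR; last exact: IntgD.
have hd := Intg_damped hp e.
apply: le_integralR; [exact: Intg_overlap|exact/IntgZ/IntgD|move=> s].
have e3 : 0 <= e ^+ 3 by rewrite exprn_ge0// ltW.
have F0 : 0 <= e ^+ 3 * (f j s + f j.+1 s) by rewrite mulr_ge0// addr_ge0.
have [s0|s0] := ltP s 0; first by rewrite damped_neg// normr0 mul0r.
rewrite indicE in_overlap; case: (boolP (_ <= s < _)) => [/andP[s1 s2]|_]; last by rewrite mulr0.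
rewrite mulr1 (le_trans (damped_le hat_ge0 e0 s0))// ler_wpM2l//.
have [sj|sj] := ltP s j%:R.
  rewrite (_ : s * transform p s = f j s) ?lerDl//.
  rewrite /f; case: eqP => [j0|_]; first by move: sj; rewrite j0 ltNge s0.
  by rewrite patchE in_unit_itv s1 sj.
rewrite (_ : s * transform p s = f j.+1 s) ?lerDr//.
by rewrite /f/= patchE in_unit_itv -natr1 addrK sj s2.
Qed.

(** An overlapping interval is the union of two consecutive bands, and
[(x + y) ^+ 2 <= 2 x ^+ 2 + 2 y ^+ 2]. *)
Lemma sum_overlap_damped e M : 0 < e ->
  \sum_(0 <= j < M) overlap_mass (damped p e) j ^+ 2 <= 4 * e ^+ 6 * B.
Proof.
move=> e0; have e6 : 0 <= e ^+ 6 by rewrite exprn_ge0// ltW.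
apply: (@le_trans _ _ (\sum_(0 <= j < M) (2 * e ^+ 6 * b j ^+ 2 + 2 * e ^+ 6 * b j.+1 ^+ 2))).
  apply: ler_sum => j _; have le1 := overlap_mass_damped j e0.
  apply: (@le_trans _ _ ((e ^+ 3 * (b j + b j.+1)) ^+ 2)).
    by rewrite lerXn2r ?nnegrE ?overlap_mass_ge0// (le_trans _ le1)// overlap_mass_ge0.
  rewrite (_ : 2 * e ^+ 6 * b j ^+ 2 + _ = e ^+ 6 * (2 * b j ^+ 2 + 2 * b j.+1 ^+ 2)); last by ring.
  rewrite exprMn -exprM ler_wpM2l//.
  by have := sqr_ge0 (b j - b j.+1); lra.
rewrite big_split/= -!big_distrr/= -mulrDr (_ : 4 * _ * B = 2 * e ^+ 6 * (B + B)); last by ring.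
apply: ler_wpM2l; [by rewrite mulr_ge0|apply: lerD].
  case: M => [|M]; first by rewrite big_geq.
  rewrite big_nat_recl// {1}/b/= expr0n add0r.
  by have := bandB M.+1; rewrite big_add1.
by have := bandB M.+1; rewrite big_add1.
Qed.

Lemma measurable_smoothed e : measurable_fun [set: R] (smoothed p e).
Proof. exact: measurable_sine_transform (Intg_damped hp e). Qed.

(** On [0, n[ the Fejer kernel of parameter [1 / (2 n)] is at least
[1 / (16 n ^+ 2)], and its triangle has width and height of order [1 / n]: this
leaves a factor [n].  The powers of [e] cancel against the mass of the smoothing
kernel. *)
Lemma smoothed_energy e (n : nat) : 0 < e -> (0 < n)%N ->
  (\int[mu]_(x in unit_itv R n)
     ((4 * smoothed p e x / \int[mu]_z smoothing e z) ^+ 2)%:E <=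
   (1024 * n%:R * B / c)%:E)%E.
Proof.
move=> e0 n0; set m := \int[mu]_z smoothing e z.
have c0 := @fejer_mass_gt0 R.
have mge : c * e ^+ 3 / 2 <= m by exact: smoothing_mass.
have m0 : 0 < m by rewrite (lt_le_trans _ mge)// divr_gt0// mulr_gt0// exprn_gt0.
have n0' : 0 < n%:R :> R by rewrite ltr0n.
pose a : R := (2 * n%:R)^-1.
have a0 : 0 < a by rewrite invr_gt0 mulr_gt0.
have aE : 2 * a * n%:R = 1 by rewrite /a; field; rewrite gt_eqF.
have a1 : 2 * a <= 1 by have : 1 <= n%:R :> R by [rewrite ler1n]; nra.
pose g := smoothed p e; pose K := 16 / m ^+ 2 * (4 / a ^+ 2).
have K0 : 0 <= K by rewrite mulr_ge0// divr_ge0// ?sqr_ge0// exprn_ge0// ltW.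
have hg2 : Intg (fun x => r a x ^+ 2 * g x ^+ 2).
  have hd := Intg_damped hp e.
  have -> : (fun x => r a x ^+ 2 * g x ^+ 2) = (fun x => r a x ^+ 2 *
      sine_transform (damped p e) x * sine_transform (damped p e) x).
    by apply/funext => x; rewrite expr2 mulrA.
  by apply: (Intg_mul_sine_transform hd); apply: (Intg_mul_sine_transform hd); exact: Intg_fejer.
have en := sine_energy (Intg_damped hp e) (@damped_neg _ p e) a0 a1
  (fun M => sum_overlap_damped M e0).
apply: (@le_trans _ _ (\int[mu]_x (K * (r a x ^+ 2 * g x ^+ 2))%:E)%E).
  rewrite integral_mkcond; apply: ge0_le_integral => //.
  - by move=> x _; rewrite patchE; case: ifP => // _; rewrite lee_fin sqr_ge0.
  - apply/(measurable_restrictT _ _).1; first exact: measurable_itv.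
    apply: measurable_funTS; apply/measurable_EFinP/measurable_funX.
    by apply: measurable_funM => //; apply: measurable_funM => //; exact: measurable_smoothed.
  - by apply/measurable_EFinP; exact: Intg_measurable (IntgZ K hg2).
  move=> x _; rewrite patchE in_unit_itv; case: ifP => [/andP[x1 x2]|_]; last first.
    by rewrite -[point]/(0%R%:E) lee_fin mulr_ge0// mulr_ge0// sqr_ge0.
  have x0 : 0 <= x by rewrite (le_trans _ x1)// subr_ge0 ler1n.
  have rge : a / 2 <= r a x.
    apply: fejer_root_ge; first exact: ltW.
    by rewrite ger0_norm ?mulr_ge0 ?(ltW a0)//; nra.
  have rge2 : 1 <= 4 / a ^+ 2 * r a x ^+ 2.
    rewrite mulrAC ler_pdivlMr ?exprn_gt0// mul1r.
    by nra.
  rewrite lee_fin (_ : (4 * smoothed p e x / m) ^+ 2 = 16 / m ^+ 2 * g x ^+ 2); last first.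
    by rewrite /g; field; rewrite gt_eqF.
  rewrite [leRHS](_ : _ = 16 / m ^+ 2 * (4 / a ^+ 2 * r a x ^+ 2 * g x ^+ 2)); last first.
    by rewrite /K; ring.
  apply: ler_wpM2l; first by rewrite divr_ge0// sqr_ge0.
  by rewrite ler_peMl ?sqr_ge0.
rewrite EFin_integral; last exact: IntgZ.
rewrite lee_fin integralZR//; apply: (le_trans (ler_wpM2l K0 en)).
have -> : K * (c * a / 2 * (4 * e ^+ 6 * B)) = 256 * n%:R * c * B * (e ^+ 6 / m ^+ 2).
  by rewrite /K /a; field; rewrite !gt_eqF.
have -> : 1024 * n%:R * B / c = 256 * n%:R * c * B * (4 / c ^+ 2).
  by field; rewrite gt_eqF.
rewrite ler_wpM2l ?mulr_ge0 ?(ltW c0)//.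
rewrite ler_pdivrMr ?exprn_gt0// mulrAC ler_pdivlMr ?exprn_gt0//.
have : (c * e ^+ 3 / 2) ^+ 2 <= m ^+ 2.
  have le0 : 0 <= c * e ^+ 3 / 2 by rewrite divr_ge0// mulr_ge0 ?exprn_ge0 ?ltW.
  by rewrite lerXn2r ?nnegrE// ltW.
rewrite (_ : (_ / 2) ^+ 2 = e ^+ 6 * c ^+ 2 / 4); last by field.
by lra.
Qed.

(** Fatou's lemma, as the bound of [smoothed_energy] does not depend on [e]. *)
Lemma square_mass_le (n : nat) : (0 < n)%N ->
  (\int[mu]_(x in unit_itv R n) ((p x / x) ^+ 2)%:E <= (1024 * n%:R * B / c)%:E)%E.
Proof.
move=> n0; set C := (1024 * n%:R * B / c)%:E.
have mI : measurable (unit_itv R n) by exact: measurable_itv.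
pose h (j : nat) x := 4 * smoothed p (j.+1%:R^-1) x / \int[mu]_z smoothing (j.+1%:R^-1) z.
pose h2 (j : nat) x := (h j x ^+ 2)%:E.
have mh2 j : measurable_fun [set: R] (h2 j).
  apply/measurable_EFinP/measurable_funX; apply: measurable_funM => //.
  by apply: measurable_funM => //; exact: measurable_smoothed.
have h20 j x : (0 <= h2 j x)%E by rewrite lee_fin sqr_ge0.
have mlim : measurable_fun [set: R] (fun x => limn_einf (h2 ^~ x)).
  under eq_fun do rewrite limn_einf_lim.
  apply: (emeasurable_fun_cvg (fun i x => einfs (h2 ^~ x) i)) => //.
    by move=> i; exact: measurable_fun_einfs.
  by move=> x _; exact: is_cvg_einfs.
have -> : (\int[mu]_(x in unit_itv R n) ((p x / x) ^+ 2)%:E =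
    \int[mu]_(x in unit_itv R n) limn_einf (h2 ^~ x))%E.
  apply: ge0_ae_eq_integral => //.
  - apply: measurable_funTS; apply/measurable_EFinP/measurable_funX.
    exact: measurable_pdiv.
  - exact: measurable_funTS.
  - by move=> x _; rewrite lee_fin sqr_ge0.
  - move=> x _; rewrite limn_einf_lim; apply: lime_ge; first exact: is_cvg_einfs.
    by apply: nearW => i; apply: le_ereal_inf_tmp => _ [k _ <-].
  have := smoothed_cvg_ae hp p0; apply: negligibleS => x; apply: contra_not => hx xn.
  have x0 : 0 <= x.
    by move: xn => /mem_set; rewrite in_unit_itv => /andP[x1 _]; rewrite (le_trans _ x1)// subr_ge0 ler1n.
  have hcvg : h j x @[j --> \oo] --> p x / x.
    (* At the origin both the sine transform and [p x / x] are 0. *)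
    move: x0; rewrite le_eqVlt => /predU1P[<-|]; last exact: hx.
    rewrite (_ : h ^~ 0 = cst 0); first by rewrite p0// mul0r; exact: cvg_cst.
    apply/funext => j; rewrite /h (_ : smoothed p _ 0 = 0) ?mulr0 ?mul0r//.
    rewrite /smoothed /sine_transform; under eq_Rintegral do rewrite mul0r sin0 mulr0.
    by rewrite Rintegral_cst// mul0r.
  apply/esym; apply: (cvg_limn_einf_sup _).1.
  apply: cvg_EFin; first exact: nearW.
  by rewrite (_ : fine \o _ = fun j => h j x * h j x)//; exact: cvgM.
have mI2 j : measurable_fun (unit_itv R n) (h2 j) by exact: measurable_funTS.
apply: (le_trans (@fatou _ _ _ mu _ mI h2 mI2 (fun j x _ => h20 j x))).
rewrite limn_einf_lim; apply: lime_le; first exact: is_cvg_einfs.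
apply: nearW => j; apply: (@le_trans _ _ (\int[mu]_(x in unit_itv R n) h2 j x)%E).
  by apply: ereal_inf_lbound; exists j => /=.
by apply: smoothed_energy; rewrite // invr_gt0.
Qed.

End square_mass.

(** * Integration against the Haar measure *)

Section omega_integral.
Context {R : realType}.
Local Notation mu := (@lebesgue_measure R).
Local Notation Intg f := (mu.-integrable [set: R] (EFin \o f)).
Local Notation H := (halfline R).

Let dens (x : R) : R := x ^+ 2 * \1_H x.

Let dens_ge0 x : 0 <= dens x. Proof. by rewrite mulr_ge0// sqr_ge0. Qed.

Let mH : measurable H. Proof. exact: measurable_itv. Qed.

Let mdens : measurable_fun [set: R] dens.
Proof. by apply: measurable_funM; [exact: measurable_funX|exact: measurable_indic]. Qed.

Import HBNNSimple.

Let integral_omega_nnsfun (h : {nnsfun R >-> R}) :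
  (\int[omega R]_x (h x)%:E = \int[mu]_x ((h x)%:E * (dens x)%:E))%E.
Proof.
have mA r : measurable (h @^-1` [set r]) by exact: measurable_sfunP.
have mr r : measurable_fun [set: R] (fun x => (r * \1_(h @^-1` [set r]) x)%:E).
  by apply/measurable_EFinP; apply: measurable_funM => //; exact: measurable_indic.
have r0 r x : (0 <= (r * \1_(h @^-1` [set r]) x)%:E)%E by rewrite EFinM nnfun_muleindic_ge0.
under [LHS]eq_integral do rewrite fimfunE -fsumEFin//.
rewrite [LHS]ge0_integral_fsum//.
under [RHS]eq_integral.
  move=> x xD; rewrite fimfunE -fsumEFin// ge0_mule_fsuml; last by move=> r; exact: r0.
  over.
rewrite [RHS]ge0_integral_fsum//; last 2 first.
  - by move=> r; apply: emeasurable_funM; [exact: mr|exact/measurable_EFinP].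
  - by move=> n x _; rewrite mule_ge0// lee_fin.
apply: eq_fsbigr => r _.
under eq_integral do rewrite EFinM.
under [RHS]eq_integral do rewrite EFinM -muleA.
have [rneg|rge0] := ltP r 0.
  rewrite preimage_nnfun0//.
  by rewrite !integral0_eq// => x _; rewrite indicE in_set0 ?mul0e mule0.
have m1 : measurable_fun [set: R] (fun x => (\1_(h @^-1` [set r]) x : R)%:E).
  by apply/measurable_EFinP; exact: measurable_indic.
rewrite ge0_integralZl_EFin// ge0_integralZl_EFin//; last 2 first.
- by move=> x _; rewrite mule_ge0// lee_fin.
- by apply: emeasurable_funM => //; exact/measurable_EFinP.
congr (_ * _)%E; rewrite integral_indic//; last exact: mA.
transitivity (omega R (h @^-1` [set r])); first by congr (omega R _); exact: setIT.
rewrite [LHS]integral_mkcond; apply: eq_integral => x _.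
by rewrite patchE [X in (X%:E * _)%E]indicE; case: ifP => _; [rewrite mul1e|rewrite mul0e].
Qed.

Let integral_omegaT (f : R -> \bar R) : measurable_fun [set: R] f ->
  (forall x, 0 <= f x)%E ->
  (\int[omega R]_x f x = \int[mu]_x (f x * (dens x)%:E))%E.
Proof.
move=> mf f0; pose h := nnsfun_approx measurableT mf.
have fE x : f x = lim ((h n x)%:E @[n --> \oo]).
  by apply/esym/cvg_lim => //; exact: cvg_nnsfun_approx.
have ndh x a b : (a <= b)%N -> h a x <= h b x.
  by move=> ab; have /lefP := nd_nnsfun_approx measurableT mf ab; exact.
have mh n : measurable_fun [set: R] (fun x => (h n x)%:E) by exact/measurable_EFinP.
transitivity (lim (\int[omega R]_x (h n x)%:E @[n --> \oo])%E).
  under eq_integral do rewrite fE.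
  apply: monotone_convergence => //.
  - by move=> n x _; rewrite lee_fin.
  - by move=> x _ a b ab; rewrite lee_fin; exact: ndh.
have fdE x : (f x * (dens x)%:E)%E = lim (((h n x)%:E * (dens x)%:E)%E @[n --> \oo]).
  apply/esym/cvg_lim => //; apply: cvgeZr => //; exact: cvg_nnsfun_approx.
under [RHS]eq_integral do rewrite fdE.
rewrite monotone_convergence//.
- by apply: congr_lim; apply/funext => n; exact: integral_omega_nnsfun.
- by move=> n; apply: emeasurable_funM; [exact: mh|exact/measurable_EFinP].
- by move=> n x _; rewrite mule_ge0// lee_fin.
- by move=> x _ a b ab; rewrite lee_wpmul2r// lee_fin//; exact: ndh.
Qed.

(** The formula holds for indicator functions by definition of [omega], and extends
to nonnegative functions by approximation with simple functions. *)
Lemma integral_omega (D : set R) (f : R -> \bar R) : measurable D ->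
  measurable_fun D f -> (forall x, D x -> 0 <= f x)%E -> D `<=` H ->
  (\int[omega R]_(x in D) f x = \int[mu]_(x in D) (f x * (x ^+ 2)%:E))%E.
Proof.
move=> mD mf f0 DH; rewrite [LHS]integral_mkcond [RHS]integral_mkcond.
rewrite integral_omegaT; last 2 first.
- exact: (measurable_restrictT f mD).1.
- by move=> x; rewrite patchE; case: ifPn => //; rewrite inE; exact: f0.
apply: eq_integral => x _; rewrite !patchE; case: ifPn => xD; last by rewrite mul0e.
by rewrite /dens indicE mem_set ?mulr1//; apply: DH; rewrite inE in xD.
Qed.

End omega_integral.

Section component.
Context {R : realType}.
Local Notation mu := (@lebesgue_measure R).
Local Notation Intg f := (mu.-integrable [set: R] (EFin \o f)).
Local Notation H := (halfline R).

Variable u : R -> R.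
Hypothesis meas_u : measurable_fun H u.
Hypothesis iu : (\int[omega R]_(x in H) `|u x|%:E < +oo)%E.

Let mH : measurable H. Proof. exact: measurable_itv. Qed.

Definition weighted : R -> R := (fun x => u x * x ^+ 2) \_ H.

Lemma measurable_weighted : measurable_fun [set: R] weighted.
Proof.
by apply: (measurable_restrictT _ mH).1; apply: measurable_funM.
Qed.

(** At 0 the weight [x ^+ 2] vanishes. *)
Lemma weighted_npos x : x <= 0 -> weighted x = 0.
Proof.
move=> x0; rewrite /weighted patchE in_halfline; case: ifPn => // x0'.
by rewrite (le_anti (introT andP (conj x0 x0'))) expr0n mulr0.
Qed.

Lemma Intg_weighted : Intg weighted.
Proof.
apply/integrableP; split; first by apply/measurable_EFinP; exact: measurable_weighted.
move: iu; rewrite integral_omega//; last first.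
  by apply/measurable_EFinP; apply: measurableT_comp.
rewrite integral_mkcond; congr (_ < _)%E; apply: eq_integral => x _.
rewrite /weighted patchE/= patchE; case: ifPn => // _; last by rewrite normr0.
by rewrite normrM -EFinM (ger0_norm (sqr_ge0 x)).
Qed.

(** [integral_omega], applied to the positive and to the negative part. *)
Lemma transform_weighted s :
  \int[omega R]_(x in H) (u x * phi s x) = transform weighted s.
Proof.
have mup : measurable_fun H (fun x => (u x * phi s x)%:E).
  apply/measurable_EFinP; apply: measurable_funM => //; apply: measurable_funTS.
  exact: measurable_phi_comp.
rewrite /transform /Rintegral; congr fine.
rewrite [LHS]integralE [RHS]integralE.
have pE x : H x -> ((weighted x * phi s x)%:E = (u x * phi s x)%:E * (x ^+ 2)%:E)%E.
  by move=> Hx; rewrite /weighted patchE mem_set// -EFinM; congr EFin; ring.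
have p0 x : ~ H x -> (weighted x * phi s x)%:E = 0%:E.
  by move=> Hx; rewrite /weighted patchE memNset// mul0r.
congr (_ - _)%E.
- rewrite integral_omega//; last exact: measurable_funepos.
  rewrite [LHS]integral_mkcond; apply: eq_integral => x _; rewrite patchE.
  have [Hx|Hx] := pselect (H x); last by rewrite memNset// funeposE p0// maxxx.
  by rewrite mem_set// !funeposE pE// maxe_pMl ?mul0e// lee_fin sqr_ge0.
- rewrite integral_omega//; last exact: measurable_funeneg.
  rewrite [LHS]integral_mkcond; apply: eq_integral => x _; rewrite patchE.
  have [Hx|Hx] := pselect (H x); last by rewrite memNset// funenegE p0// oppe0 maxxx.
  by rewrite mem_set// !funenegE pE// maxe_pMl ?mul0e ?mulNe// lee_fin sqr_ge0.
Qed.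

Lemma integral_omega_sqr (A : set R) : measurable A -> A `<=` H ->
  (\int[omega R]_(x in A) (u x ^+ 2)%:E =
   \int[mu]_(x in A) ((weighted x / x) ^+ 2)%:E)%E.
Proof.
move=> mA AH; rewrite integral_omega//; last 2 first.
- by apply/measurable_EFinP/measurable_funX; exact: measurable_funS meas_u.
- by move=> x _; rewrite lee_fin sqr_ge0.
apply: eq_integral => x /[1!inE] xA; rewrite -EFinM; congr EFin.
rewrite /weighted patchE mem_set; last exact: AH.
have [->|x0] := eqVneq x 0; first by rewrite expr0n mulr0 mulr0 mul0r expr0n.
by field.
Qed.

End component.

(** * Unit intervals *)

Section unit_intervals.
Context {R : realType}.
Local Notation mu := (@lebesgue_measure R).
Local Notation Intg f := (mu.-integrable [set: R] (EFin \o f)).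
Local Notation H := (halfline R).
Local Notation I := (unit_itv R).

Lemma unit_itv_halfline n : (0 < n)%N -> I n `<=` H.
Proof.
move=> n0 x /mem_set; rewrite in_unit_itv => /andP[h _].
have : x \in H by rewrite in_halfline (le_trans _ h)// subr_ge0 ler1n.
by rewrite inE.
Qed.

Lemma measurable_unit_itv n : measurable (I n).
Proof. exact: measurable_itv. Qed.

Definition unit_mass n := \int[mu]_x ((fun x => x ^+ 2) \_ (I n)) x.

Lemma unit_itv_sqr_le n x : (0 < n)%N -> x \in I n -> 0 <= x <= n%:R.
Proof.
move=> n0; rewrite in_unit_itv => /andP[h1 h2].
by rewrite (le_trans _ h1) ?subr_ge0 ?ler1n// ltW.
Qed.

Lemma Intg_unit_sqr n : (0 < n)%N -> Intg ((fun x => x ^+ 2) \_ (I n)).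
Proof.
move=> n0; apply: (@Intg_patch_unit_itv _ _ (n%:R ^+ 2)); first exact: measurable_funX.
move=> x /(unit_itv_sqr_le n0)/andP[x0 xn].
by rewrite ger0_norm ?sqr_ge0// lerXn2r ?nnegrE.
Qed.

Lemma omega_unit_itv n : (0 < n)%N -> omega R (I n) = (unit_mass n)%:E.
Proof.
move=> n0; rewrite -EFin_integral; last exact: Intg_unit_sqr.
rewrite /omega [LHS]integral_mkcond; apply: eq_integral => x _.
rewrite /= !patchE; case: ifPn => // xn.
have /andP[x0 _] := unit_itv_sqr_le n0 xn.
by rewrite indicE in_halfline x0 mulr1.
Qed.

(** On the upper half of the interval, [x >= n / 2]. *)
Lemma unit_mass_ge n : (0 < n)%N -> n%:R ^+ 2 / 8 <= unit_mass n.
Proof.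
move=> n0; have n1 : 1 <= n%:R :> R by rewrite ler1n.
pose J : set R := `[n%:R - 2^-1, n%:R[%classic.
have mJ : measurable J by exact: measurable_itv.
have hJ : Intg (\1_J) by exact: integrable_indic_itv.
have JI : \int[mu]_x \1_J x = 2^-1.
  have h : lebesgue_measure J = 2^-1%:E.
    rewrite lebesgue_measure_itv/= lte_fin ltrBlDr ltrDl invr_gt0 ltr0n/=.
    by rewrite -EFinB opprB addrC subrK.
  by rewrite /Rintegral integral_indic// setIT; exact: (congr1 fine h).
have -> : n%:R ^+ 2 / 8 = n%:R ^+ 2 / 4 * \int[mu]_x \1_J x by rewrite JI; field.
rewrite -(integralZR _ hJ); apply: le_integralR; [exact: IntgZ|exact: Intg_unit_sqr|].
move=> x; rewrite patchE indicE; case: (boolP (x \in J)); last first.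
  by rewrite mulr0; case: ifP => // _ _; exact: sqr_ge0.
rewrite inE /J/= in_itv/= => /andP[h1 h2].
have x0 : n%:R / 2 <= x by lra.
have -> : x \in I n by rewrite in_unit_itv h2 andbT; lra.
rewrite mulr1 (_ : n%:R ^+ 2 / 4 = (n%:R / 2) ^+ 2); last by field.
by rewrite lerXn2r ?nnegrE ?divr_ge0// (le_trans _ x0)// divr_ge0.
Qed.

Lemma unit_mass_le n : (0 < n)%N -> unit_mass n <= n%:R ^+ 2.
Proof.
move=> n0; have hI : Intg (\1_(I n)) by exact: integrable_indic_itv.
have II : \int[mu]_x \1_(I n) x = 1.
  have h : lebesgue_measure (I n) = 1%:E.
    rewrite lebesgue_measure_itv/= lte_fin ltrBlDr ltrDl ltr01.
    by rewrite -EFinB opprB addrC subrK.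
  have mI := measurable_unit_itv n.
  by rewrite /Rintegral integral_indic// setIT; exact: (congr1 fine h).
rewrite -[leRHS]mulr1 -[X in _ <= _ * X]II -(integralZR _ hI).
apply: le_integralR; [exact: Intg_unit_sqr|exact: IntgZ|move=> x].
rewrite patchE indicE; case: (boolP (x \in I n)) => xn; last by rewrite mulr0.
have /andP[x0 x1] := unit_itv_sqr_le n0 xn.
by rewrite mulr1 lerXn2r ?nnegrE.
Qed.

Lemma unit_mass_gt0 n : (0 < n)%N -> 0 < unit_mass n.
Proof.
move=> n0; apply: lt_le_trans (unit_mass_ge n0).
by rewrite divr_gt0// exprn_gt0// ltr0n.
Qed.

Lemma omega_unit_itvV n : (0 < n)%N -> ((omega R (I n))^-1 = ((unit_mass n)^-1)%:E)%E.
Proof. by move=> n0; rewrite omega_unit_itv// inver gt_eqF// unit_mass_gt0. Qed.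

End unit_intervals.

(** * Modulus of a complex function *)

Section modulus.
Context {R : realType}.
Implicit Types z : R[i]%C.

Lemma cmod_sqr z : cmod z ^+ 2 = complex.Re z ^+ 2 + complex.Im z ^+ 2.
Proof. by case: z => a b; rewrite /cmod/= sqr_sqrtr// addr_ge0 ?sqr_ge0. Qed.

Lemma cmod_ge0 z : 0 <= cmod z.
Proof. by case: z => a b; rewrite /cmod/= sqrtr_ge0. Qed.

Lemma Re_le_cmod z : `|complex.Re z| <= cmod z.
Proof.
rewrite -ler_sqr ?nnegrE ?cmod_ge0// cmod_sqr real_normK ?num_real//.
by rewrite lerDl sqr_ge0.
Qed.

Lemma Im_le_cmod z : `|complex.Im z| <= cmod z.
Proof.
rewrite -ler_sqr ?nnegrE ?cmod_ge0// cmod_sqr real_normK ?num_real//.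
by rewrite lerDr sqr_ge0.
Qed.

Lemma cmod_of_ge0 z : 0 <= z -> cmod z = complex.Re z.
Proof.
case: z => a b; rewrite lecE/= => /andP[/eqP -> a0].
by rewrite /cmod/= expr0n addr0 sqrtr_sqr ger0_norm.
Qed.

Lemma measurable_cmod_EFin (D : set R) (h : R -> R[i]%C) : cmeasurable D h ->
  measurable_fun D (fun x => (cmod (h x))%:E).
Proof.
move=> [m1 m2]; apply/measurable_EFinP.
rewrite (_ : (fun _ => _) = (@Num.sqrt R) \o
    (fun x => complex.Re (h x) ^+ 2 + complex.Im (h x) ^+ 2)); last first.
  by apply/funext => x /=; case: (h x).
apply: measurableT_comp.
  by apply: continuous_measurable_fun; exact: sqrt_continuous.
by apply: measurable_funD; exact: measurable_funX.
Qed.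

End modulus.

(** * The three conditions *)

Section amalgams.
Context {R : realType}.
Implicit Types f : R -> R[i]%C.

Definition re_weight f := weighted (fun x => complex.Re (f x)).
Definition im_weight f := weighted (fun x => complex.Im (f x)).
Definition square_band_mass f (n : nat) : R := \int[@lebesgue_measure R]_s
  ((fun s => s ^+ 2 * transform (re_weight f) s) \_ (unit_itv R n)) s.

Local Notation mu := (@lebesgue_measure R).
Local Notation Intg f := (mu.-integrable [set: R] (EFin \o f)).
Local Notation H := (halfline R).
Local Notation I := (unit_itv R).
Local Notation c := (@fejer_mass R).

Variable f : R -> R[i]%C.
Hypothesis f_L1 : L1omega R f.
Hypothesis fhat_ge0 : forall s : R, 0 <= s -> 0 <= fourier f s.

Local Notation u := (fun x => complex.Re (f x)).
Local Notation v := (fun x => complex.Im (f x)).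
Local Notation p := (re_weight f).
Local Notation q := (im_weight f).
Local Notation F := (transform p).
Local Notation A := (square_band_mass f).

Let meas_u : measurable_fun H u. Proof. by case: f_L1 => -[]. Qed.
Let meas_v : measurable_fun H v. Proof. by case: f_L1 => -[]. Qed.

Let mH : measurable H. Proof. exact: measurable_itv. Qed.

Let iu : (\int[omega R]_(x in H) `|u x|%:E < +oo)%E.
Proof.
case: f_L1 => -[m1 m2]; apply: le_lt_trans; apply: ge0_le_integral => //.
- by apply/measurable_EFinP; exact: measurableT_comp.
- exact: measurable_cmod_EFin.
- by move=> x _; rewrite lee_fin Re_le_cmod.
Qed.

Let iv : (\int[omega R]_(x in H) `|v x|%:E < +oo)%E.
Proof.
case: f_L1 => -[m1 m2]; apply: le_lt_trans; apply: ge0_le_integral => //.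
- by apply/measurable_EFinP; exact: measurableT_comp.
- exact: measurable_cmod_EFin.
- by move=> x _; rewrite lee_fin Im_le_cmod.
Qed.

Let hp : Intg p. Proof. exact: Intg_weighted. Qed.
Let hq : Intg q. Proof. exact: Intg_weighted. Qed.
Let p0 x : x <= 0 -> p x = 0. Proof. exact: weighted_npos. Qed.
Let q0 x : x <= 0 -> q x = 0. Proof. exact: weighted_npos. Qed.

Lemma fourierE s : fourier f s = (F s +i* transform q s)%C.
Proof.
rewrite -!transform_weighted// /fourier /cintegral; congr (_ +i* _)%C.
  apply: eq_Rintegral => x _ /=; case: (f x) => a b /=.
  by rewrite mulr0 subr0.
apply: eq_Rintegral => x _ /=; case: (f x) => a b /=.
by rewrite mulr0 add0r.
Qed.

Let F_ge0 s : 0 <= s -> 0 <= F s.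
Proof. by move=> /fhat_ge0; rewrite fourierE lecE/= => /andP[]. Qed.

Let transform_Im s : 0 <= s -> transform q s = 0.
Proof. by move=> /fhat_ge0; rewrite fourierE lecE/= => /andP[/eqP]. Qed.

Let cmod_fourier s : 0 <= s -> cmod (fourier f s) = F s.
Proof. by move=> s0; rewrite cmod_of_ge0 ?fhat_ge0// fourierE. Qed.

Let mF : measurable_fun [set: R] F.
Proof. exact: measurable_transform (Intg_measurable hp). Qed.

Lemma cmeasurable_fourier : cmeasurable H (fourier f).
Proof.
split; apply: measurable_funTS.
  by rewrite (_ : (fun _ => _) = F)//; apply/funext => s; rewrite fourierE.
rewrite (_ : (fun _ => _) = transform q); last by apply/funext => s; rewrite fourierE.
exact: measurable_transform (Intg_measurable hq).
Qed.

Let Intg_A n : (0 < n)%N -> Intg ((fun s => s ^+ 2 * F s) \_ (I n)).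
Proof.
move=> n0; apply: (@Intg_patch_unit_itv _ _ (n%:R ^+ 2 * \int[mu]_y `|p y|)).
  by apply: measurable_funM => //; exact: measurable_funX.
move=> s /(unit_itv_sqr_le n0)/andP[s0 sn].
by rewrite normrM ler_pM ?transform_le// ger0_norm ?sqr_ge0// lerXn2r ?nnegrE.
Qed.

Let bandE n : band_mass p n = \int[mu]_s ((fun s => s * F s) \_ (I n)) s.
Proof. by rewrite /band_mass Rintegral_mkcond. Qed.

Let A_le n : (0 < n)%N -> A n <= n%:R * band_mass p n.
Proof.
move=> n0; have hb := Intg_band hp n0.
rewrite bandE -(integralZR _ hb); apply: le_integralR; [exact: Intg_A|exact: IntgZ|].
move=> s; rewrite !patchE; case: ifPn => [sn|_]; last by rewrite mulr0.
have /andP[s0 s1] := unit_itv_sqr_le n0 sn.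
by rewrite expr2 -mulrA ler_wpM2r// mulr_ge0// F_ge0.
Qed.

Let A_ge n : (0 < n)%N -> (n%:R - 1) * band_mass p n <= A n.
Proof.
move=> n0; have hb := Intg_band hp n0.
rewrite bandE -(integralZR _ hb); apply: le_integralR; [exact: IntgZ|exact: Intg_A|].
move=> s; rewrite !patchE; case: ifPn => [sn|_]; last by rewrite mulr0.
have /andP[s0 s1] := unit_itv_sqr_le n0 sn.
rewrite expr2 -mulrA ler_wpM2r//; first by rewrite mulr_ge0// F_ge0.
by move: sn; rewrite in_unit_itv => /andP[].
Qed.

Let A_ge0 n : (0 < n)%N -> 0 <= A n.
Proof.
move=> n0; apply: le_trans (A_ge n0).
by rewrite mulr_ge0 ?subr_ge0 ?ler1n// band_ge0.
Qed.

Let mean1E n : (0 < n)%N -> mean_pow 1 (fourier f) n = (A n / unit_mass n)%:E.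
Proof.
move=> n0; rewrite /mean_pow omega_unit_itvV// [in RHS]mulrC EFinM; congr (_ * _)%E.
transitivity (\int[omega R]_(x in I n) (F x)%:E)%E.
  apply: eq_integral => s sn; have /andP[s0 _] := unit_itv_sqr_le n0 sn.
  by rewrite powRr1 ?cmod_ge0// cmod_fourier.
rewrite integral_omega; last 4 first.
- exact: measurable_unit_itv.
- by apply: measurable_funTS; apply/measurable_EFinP.
- by move=> s /mem_set/(unit_itv_sqr_le n0)/andP[s0 _]; rewrite lee_fin F_ge0.
- exact: unit_itv_halfline.
rewrite -EFin_integral; last exact: Intg_A.
rewrite [LHS]integral_mkcond; apply: eq_integral => s _; rewrite /= !patchE.
by case: ifP => // _; rewrite -EFinM mulrC.
Qed.

(** The partial sums are nondecreasing, hence converge to their supremum. *)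
Lemma amalgam12E : amalgam_norm 1 2%:E (fourier f) =
  (ereal_sup (range (fun M => (\sum_(1 <= n < M) A n ^+ 2 / unit_mass n)%:E)) `^ 2^-1)%E.
Proof.
rewrite /amalgam_norm; congr (_ `^ _)%E.
transitivity (limn (fun M => (\sum_(1 <= n < M) A n ^+ 2 / unit_mass n)%:E)).
  apply: congr_lim; apply/funext => M; rewrite -sumEFin; apply: eq_big_nat => n /andP[n0 _].
  rewrite mean1E// omega_unit_itv// divr1 poweR_EFin -EFinM; congr EFin.
  have W0 := @unit_mass_gt0 R n n0.
  rewrite powR_mulrn ?divr_ge0 ?A_ge0 ?ltW//.
  by field; rewrite gt_eqF.
apply/cvg_lim => //; apply: ereal_nondecreasing_cvgn => M N MN.
rewrite lee_fin; have [M1|M1] := leqP M 1.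
  rewrite (big_geq M1) big_nat_cond sumr_ge0// => n /andP[/andP[n0 _] _].
  by rewrite divr_ge0 ?sqr_ge0 ?ltW ?unit_mass_gt0.
rewrite (@big_cat_nat _ _ _ M 1 N xpredT (fun n => A n ^+ 2 / unit_mass n) (ltnW M1) MN)/=.
rewrite lerDl big_nat_cond sumr_ge0// => n /andP[/andP[n0 _] _].
by rewrite divr_ge0 ?sqr_ge0 ?ltW ?unit_mass_gt0// (leq_trans _ n0)// ltnW.
Qed.

(** On the [n]-th interval [s] lies between [n - 1] and [n], so the integral of
[s ^+ 2 * F s] is comparable to [n] times the band mass, and the Haar mass to
[n ^+ 2]; the first band, where [s] is not bounded below, is a single term. *)
Lemma amalgam12P : (amalgam_norm 1 2%:E (fourier f) < +oo)%E <->
  exists B : R, forall M : nat, \sum_(1 <= m < M) band_mass p m ^+ 2 <= B.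
Proof.
rewrite amalgam12E; split=> [fin|[B hB]].
  pose S := ereal_sup (range (fun M => (\sum_(1 <= n < M) A n ^+ 2 / unit_mass n)%:E)).
  have Sub M : ((\sum_(1 <= n < M) A n ^+ 2 / unit_mass n)%:E <= S)%E.
    by apply: ereal_sup_ubound; exists M.
  have Soo : (S < +oo)%E.
    rewrite ltey; apply/eqP => Se; move: fin; rewrite -/S Se poweRyr ?invr_eq0//.
  have Sfin : S \is a fin_num.
    rewrite ge0_fin_numE//; apply: le_trans (Sub 0); by rewrite big_geq.
  exists (band_mass p 1 ^+ 2 + 4 * fine S) => M.
  have [M1|M1] := leqP M 1.
    have := Sub 0; rewrite big_geq// -[X in (_ <= X)%E](fineK Sfin) lee_fin => S0.
    by rewrite (big_geq M1) addr_ge0 ?sqr_ge0 ?mulr_ge0.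
  have := Sub M; rewrite -[X in (_ <= X)%E](fineK Sfin) lee_fin => SM.
  rewrite big_ltn// lerD2l.
  rewrite big_ltn// in SM.
  apply: (@le_trans _ _ (4 * \sum_(2 <= n < M) A n ^+ 2 / unit_mass n)); last first.
    rewrite ler_wpM2l//; apply: le_trans SM; rewrite lerDr.
    by rewrite divr_ge0 ?sqr_ge0 ?ltW ?unit_mass_gt0.
  rewrite big_distrr/= big_nat_cond [leRHS]big_nat_cond; apply: ler_sum => n /andP[/andP[n2 _] _].
  have n0 : (0 < n)%N by rewrite ltnW.
  have W0 := @unit_mass_gt0 R n n0; have Wle := @unit_mass_le R n n0.
  have n2' : 2 <= n%:R :> R by rewrite (ler_nat _ 2).
  have b0 := band_ge0 F_ge0 n0; have Age := A_ge n0.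
  rewrite mulrA ler_pdivlMr//.
  apply: (@le_trans _ _ (band_mass p n ^+ 2 * n%:R ^+ 2)); first by rewrite ler_wpM2l ?sqr_ge0.
  (* For [n >= 2] one has [n <= 2 * (n - 1)]. *)
  apply: (@le_trans _ _ ((2 * ((n%:R - 1) * band_mass p n)) ^+ 2)).
    rewrite -exprMn lerXn2r ?nnegrE ?mulr_ge0 ?subr_ge0 ?ler1n//.
    rewrite mulrC mulrA ler_wpM2r//; lra.
  rewrite exprMn -natrX ler_wpM2l// lerXn2r ?nnegrE ?A_ge0//.
  by rewrite mulr_ge0// subr_ge0 ler1n.
apply: poweR_lty; apply: (@le_lt_trans _ _ (8 * B)%:E); last exact: ltry.
apply: ge_ereal_sup => _ [M _ <-]; rewrite lee_fin.
apply: (@le_trans _ _ (\sum_(1 <= n < M) 8 * band_mass p n ^+ 2)); last first.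
  by rewrite -big_distrr/= ler_wpM2l.
rewrite big_nat_cond [leRHS]big_nat_cond; apply: ler_sum => n /andP[/andP[n0 _] _].
have W0 := @unit_mass_gt0 R n n0; have Wge := @unit_mass_ge R n n0.
have b0 := band_ge0 F_ge0 n0.
rewrite ler_pdivrMr//; apply: (@le_trans _ _ ((n%:R * band_mass p n) ^+ 2)).
  by rewrite lerXn2r ?nnegrE ?A_ge0 ?mulr_ge0 ?A_le.
apply: (@le_trans _ _ (8 * band_mass p n ^+ 2 * (n%:R ^+ 2 / 8))); last first.
  by rewrite ler_wpM2l// mulr_ge0// sqr_ge0.
by rewrite le_eqVlt; apply/orP; left; apply/eqP; field.
Qed.

Lemma band_bounded_of_near0 : square_integrable_near0 f ->
  exists B : R, forall M : nat, \sum_(1 <= m < M) band_mass p m ^+ 2 <= B.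
Proof.
move=> [U [UH mU nU Ufin]].
move/nbhs_ballP : nU => [e /= e0 eU].
pose J : set R := `[0, e / 2]%classic.
have JU : J `<=` U.
  move=> y; rewrite /J/= in_itv/= => /andP[y0 ye]; apply: eU.
    rewrite -ball_normE/= sub0r normrN ger0_norm//.
    by apply: le_lt_trans ye _; rewrite ltr_pdivrMr// ltr_pMr// ltr1n.
  by apply/set_mem; rewrite in_halfline.
have mJ : measurable J by exact: measurable_itv.
have JH : J `<=` H by apply: subset_trans UH.
apply: (@sum_band_bounded _ _ hp p0 F_ge0 (e / 2)); first by rewrite divr_gt0.
apply/integrableP; split.
  apply/measurable_EFinP; apply: measurable_funM; last exact: measurable_indic.
  exact: measurable_funX (measurable_pdiv hp).
apply: le_lt_trans Ufin.
apply: (@le_trans _ _ (\int[omega R]_(x in J) (u x ^+ 2)%:E)%E).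
  rewrite integral_omega_sqr// [leRHS]integral_mkcond.
  rewrite le_eqVlt; apply/orP; left; apply/eqP; apply: eq_integral => x _.
  rewrite /= patchE indicE -/J; case: ifP => _; last by rewrite mulr0 normr0.
  by rewrite mulr1 ger0_norm ?sqr_ge0.
have mc : measurable_fun U (fun x => (cmod (f x) ^+ 2)%:E).
  have /measurable_EFinP mcH : measurable_fun U (fun x => (cmod (f x))%:E).
    apply: measurable_cmod_EFin; split; [exact: measurable_funS meas_u|].
    exact: measurable_funS meas_v.
  by apply/measurable_EFinP; apply: measurable_funX.
apply: (@le_trans _ _ (\int[omega R]_(x in J) (cmod (f x) ^+ 2)%:E)%E).
  apply: ge0_le_integral => //.
  - by move=> x _; rewrite lee_fin sqr_ge0.
  - by apply/measurable_EFinP/measurable_funX; exact: measurable_funS meas_u.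
  - exact: measurable_funS mc.
  - by move=> x _; rewrite lee_fin cmod_sqr lerDl sqr_ge0.
by apply: ge0_subset_integral => // x _; rewrite lee_fin sqr_ge0.
Qed.

Lemma square_integrable_near0_of_amalgam : amalgam 2 +oo f -> square_integrable_near0 f.
Proof.
move=> [mf fin]; exists (I 1); split.
- exact: unit_itv_halfline.
- exact: measurable_unit_itv.
- apply/nbhs_ballP; exists 1 => //= y; rewrite -ball_normE/= sub0r normrN => y1 Hy.
  have y0 : 0 <= y by rewrite -in_halfline inE.
  have : y \in I 1 by rewrite in_unit_itv subrr y0 (le_lt_trans (ler_norm _) y1).
  by rewrite inE.
have mI := @measurable_unit_itv R 1.
have : (mean_pow 2 f 1 `^ 2^-1 < +oo)%E.
  by apply: le_lt_trans fin; apply: ereal_sup_ubound; exists 1%N.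
rewrite ltey => /eqP h1; have : mean_pow 2 f 1 != +oo%E.
  by apply/eqP => h2; apply: h1; rewrite h2 poweRyr ?invr_eq0.
rewrite /mean_pow omega_unit_itvV//.
under eq_integral do rewrite powR_mulrn ?cmod_ge0//.
apply: contra_neqT; rewrite -leNgt leye_eq => /eqP ->.
by rewrite gt0_muley// lte_fin invr_gt0 unit_mass_gt0.
Qed.

(** The transform of the imaginary part vanishes on the half-line, so that
[square_mass_le] applies to it with bound 0. *)
Lemma amalgam_of_band_bounded (B : R) :
  (forall M : nat, \sum_(1 <= m < M) band_mass p m ^+ 2 <= B) -> amalgam 2 +oo f.
Proof.
move=> hB; split; first by case: f_L1.
have c0 := @fejer_mass_gt0 R.
have B0 : 0 <= B by have := hB 0; rewrite big_geq.
have hB' M : \sum_(1 <= m < M) band_mass q m ^+ 2 <= 0.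
  rewrite big_nat_cond big1// => m /andP[/andP[m0 _] _].
  rewrite (_ : band_mass q m = 0) ?expr0n//.
  rewrite /band_mass; transitivity (\int[mu]_(s in I m) (0 : R)).
    apply: eq_Rintegral => s /(unit_itv_sqr_le m0)/andP[s0 _].
    by rewrite transform_Im// mulr0.
  by rewrite Rintegral_cst ?mul0r//; exact: measurable_unit_itv.
have q_ge0 s : 0 <= s -> 0 <= transform q s by move=> /transform_Im ->.
have [C C0 hC] : exists2 C : R, 0 <= C & forall n, (0 < n)%N ->
    (\int[mu]_(x in I n) ((p x / x) ^+ 2)%:E + \int[mu]_(x in I n) ((q x / x) ^+ 2)%:E
     <= (C * n%:R)%:E)%E.
  exists (1024 * B / c); first exact: divr_ge0 (mulr_ge0 (ler0n _ _) B0) (ltW c0).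
  move=> n n0; have h1 := square_mass_le hp p0 F_ge0 hB n0.
  have h2 := square_mass_le hq q0 q_ge0 hB' n0.
  apply: (le_trans (leeD h1 h2)); rewrite mulr0 mul0r adde0 lee_fin.
  by rewrite (_ : 1024 * B / c * n%:R = 1024 * n%:R * B / c)//; ring.
have mean_le n : (0 < n)%N -> (mean_pow 2 f n <= (8 * C)%:E)%E.
  move=> n0; have mI := @measurable_unit_itv R n; have IH := @unit_itv_halfline R n n0.
  have n0' : 1 <= n%:R :> R by rewrite ler1n.
  have mu2 (w : R -> R) : measurable_fun H w -> measurable_fun (I n) (fun x => (w x ^+ 2)%:E).
    move=> mw; apply/measurable_EFinP/measurable_funX; exact: measurable_funS mw.
  have le1 : (\int[omega R]_(x in I n) (cmod (f x) `^ 2)%:E <= (C * n%:R)%:E)%E.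
    rewrite (_ : (\int[omega R]_(x in I n) _)%E =
        (\int[omega R]_(x in I n) ((u x ^+ 2)%:E + (v x ^+ 2)%:E))%E); last first.
      by apply: eq_integral => x _; rewrite powR_mulrn ?cmod_ge0// cmod_sqr EFinD.
    rewrite ge0_integralD//; last 4 first.
    - by move=> x _; rewrite lee_fin sqr_ge0.
    - exact: mu2.
    - by move=> x _; rewrite lee_fin sqr_ge0.
    - exact: mu2.
    by rewrite !integral_omega_sqr// hC.
  rewrite /mean_pow omega_unit_itvV//.
  have W0 := @unit_mass_gt0 R n n0; have Wge := @unit_mass_ge R n n0.
  apply: (le_trans (lee_wpmul2l _ le1)); first by rewrite lee_fin invr_ge0 ltW.
  rewrite -EFinM lee_fin mulrC ler_pdivrMr//.
  have -> : C * n%:R = 8 * C * (n%:R / 8) by field.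
  rewrite ler_wpM2l ?mulr_ge0//; apply: le_trans Wge.
  by rewrite ler_wpM2r// expr2 ler_peMl.
rewrite /amalgam_norm; apply: (@le_lt_trans _ _ ((8 * C)%:E `^ 2^-1)%E); last first.
  by rewrite poweR_EFin ltry.
apply: ge_ereal_sup => _ [n n0 <-].
have bnd0 : 0 <= 8 * C by rewrite mulr_ge0.
have m0 : (0 <= mean_pow 2 f n)%E.
  rewrite /mean_pow mule_ge0//; last by apply: integral_ge0 => x _; rewrite lee_fin powR_ge0.
  by rewrite omega_unit_itvV// lee_fin invr_ge0 ltW// unit_mass_gt0.
apply: gt0_ler_poweR; rewrite ?invr_ge0 ?in_itv/= ?m0 ?leey ?lee_fin ?bnd0//.
exact: mean_le.
Qed.

End amalgams.

Theorem theorem22 (R : realType) (f : R -> R[i]%C)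
    (f_L1 : L1omega R f)
    (fhat_ge0 : forall lambda : R, 0 <= lambda -> 0 <= fourier f lambda) :
  [<-> square_integrable_near0 f;
       amalgam 1 2%:E (fourier f);
       amalgam 2 +oo%E f].
Proof.
tfae.
- move=> /(band_bounded_of_near0 f_L1 fhat_ge0) hB; split.
    exact: cmeasurable_fourier.
  exact/(amalgam12P f_L1 fhat_ge0).
- by move=> [_ /(amalgam12P f_L1 fhat_ge0)[B /(amalgam_of_band_bounded f_L1 fhat_ge0)]].
- exact: square_integrable_near0_of_amalgam.
Qed.
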